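(* Let $1<p<\infty$, and let $F$ be a separable $\mathcal{L}_{p,1+}$-space. Let $E$ be a Banach space such that $E^*$ is separable. If $Z\subseteq\mathcal{B}(E,F)$ is a closed subspace containing $\mathcal{F}(E,F)$, then $Z$ has the UBCP.
   Context: $\mathcal{B}(E,F)$ is the Banach space of bounded linear operators $E\to F$ with the operator norm, and $\mathcal{F}(E,F)$ is its subspace of bounded finite-rank operators. Uniform ball-covering property (UBCP): a Banach space $Z$ with unit sphere $S_Z$ has the UBCP if there exist $r>0$ and a sequence $(z_j)_{j\ge1}$ in $Z$ such that $S_Z\subseteq\bigcup_{j\ge1}B(z_j,r)$ and $r<\inf_{j\ge1}\|z_j\|$, where $B(z,r)$ is the open ball with center $z$ and radius $r$. By convention, if $Z=\{0\}$ (so $S_Z=\emptyset$) the UBCP assertion is regarded as trivially true. Banach–Mazur distance: $d_{BM}(X,Y)=\inf\{\|T\|\cdot\|T^{-1}\| : T:X\to Y \text{ an isomorphism}\}$, and $d_{BM}(X,Y)=\infty$ if $X,Y$ are not isomorphic. $\mathcal{L}_{p,1+}$-space: a Banach space $F$ such that for every $\varepsilon>0$ and every finite-dimensional subspace $H\subseteq F$ there is a finite-dimensional subspace $G\subseteq F$ with $H\subseteq G$ and $d_{BM}(G,\ell_p^{\dim G})<1+\varepsilon$. *)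

(* Defs.v *)
From HB Require Import structures.
From mathcomp Require Import all_boot all_order all_algebra.
From mathcomp Require Import complex ring.
From mathcomp Require Import all_classical all_reals all_analysis.

Set Implicit Arguments.
Unset Strict Implicit.
Unset Printing Implicit Defensive.

Import Order.TTheory GRing.Theory Num.Theory.
Import numFieldNormedType.Exports.

Local Open Scope classical_set_scope.
Local Open Scope ring_scope.

Variant scalars := RealScalars | ComplexScalars.

Definition scalarField (R : realType) (s : scalars) : numFieldType :=
  if s is ComplexScalars then R[i] : numFieldType else R : numFieldType.

(* The norm of a normedModType over K takes its values in K, so over R[i] the  *)
(* real norms, suprema and distances are read through realPart and ofReal;     *)
(* both maps are the identity for real scalars.                                *)
Definition realPart (R : realType) (s : scalars) : scalarField R s -> R :=
  match s return scalarField R s -> R with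
  | RealScalars => fun x => x
  | ComplexScalars => fun x => complex.Re x
  end.

Definition ofReal (R : realType) (s : scalars) : R -> scalarField R s :=
  match s return R -> scalarField R s with
  | RealScalars => fun x => x
  | ComplexScalars => fun x => x%:C%C
  end.
Arguments ofReal {R} s _.

Section scalar_theory.
Context {R : realType} {s : scalars}.
Local Notation K := (scalarField R s).

Lemma ofRealK : cancel (ofReal s) (@realPart R s).
Proof. by case: s. Qed.

Lemma ler_ofReal (a b : R) : (ofReal s a <= ofReal s b) = (a <= b).
Proof. by case: s => //=; rewrite lecR. Qed.

Lemma ofRealD (a b : R) : ofReal s (a + b) = ofReal s a + ofReal s b.
Proof. by case: s => //=; rewrite raddfD. Qed.

Lemma ofRealM (a b : R) : ofReal s (a * b) = ofReal s a * ofReal s b.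
Proof. by case: s => //=; rewrite rmorphM. Qed.

Lemma ofReal0 : ofReal s (0 : R) = 0.
Proof. by case: s. Qed.

Lemma ofReal_norm (V : normedZmodType K) (x : V) :
  ofReal s (realPart `|x|) = `|x|.
Proof.
have := normr_ge0 x; move: (`|x|) => {x}; case: s => //= -[a b].
by rewrite lecE /= => /andP[/eqP -> _].
Qed.

End scalar_theory.

Section real_norm.
Context {R : realType} {s : scalars}.
Local Notation K := (scalarField R s).

Definition rnorm (V : normedZmodType K) (x : V) : R := realPart `|x|.

Context {V : normedModType K}.
Implicit Types x y : V.

Lemma rnormE x : ofReal s (rnorm x) = `|x|.
Proof. exact: ofReal_norm. Qed.

Lemma rnorm_ge0 x : 0 <= rnorm x.
Proof. by rewrite -(ler_ofReal (s := s)) rnormE ofReal0. Qed.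

Lemma rnormD x y : rnorm (x + y) <= rnorm x + rnorm y.
Proof. by rewrite -(ler_ofReal (s := s)) ofRealD !rnormE ler_normD. Qed.

Lemma rnormZ (a : K) x : rnorm (a *: x) = rnorm a * rnorm x.
Proof.
by apply: (can_inj (@ofRealK R s)); rewrite ofRealM !ofReal_norm normrZ.
Qed.

Lemma rnorm0 : rnorm (0 : V) = 0.
Proof. by rewrite /rnorm normr0 -[RHS](@ofRealK R s) ofReal0. Qed.

Lemma rnorm0_eq0 x : rnorm x = 0 -> x = 0.
Proof.
by move=> x0; apply/eqP; rewrite -normr_eq0 -rnormE x0 ofReal0.
Qed.

End real_norm.

Section bounded_operators.
Context {R : realType} {s : scalars}.
Local Notation K := (scalarField R s).
Variables E F : normedModType K.

Definition bounded_linear : {pred E -> F} := [pred f : E -> F | `[<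
  linear f /\ exists M : R, forall x, rnorm (f x) <= M * rnorm x >]].

Lemma bounded_linear_submod : submod_closed bounded_linear.
Proof.
split.
  apply/asboolP; split; first by move=> a x y; rewrite /= scaler0 addr0.
  by exists 0 => x /=; rewrite rnorm0 mul0r.
move=> a f g /asboolP[lf [M fM]] /asboolP[lg [N gN]]; apply/asboolP; split.
  move=> b x y; have fgE u : (a *: f + g) u = a *: f u + g u by [].
  by rewrite !fgE lf lg !scalerDr !scalerA (mulrC a) addrACA.
exists (rnorm a * M + N) => x; apply: le_trans (rnormD _ _) _.
rewrite mulrDl lerD // rnormZ -mulrA ler_wpM2l ?fM //.
exact: (@rnorm_ge0 R s K^o).
Qed.

HB.instance Definition _ :=
  GRing.isSubmodClosed.Build K (E -> F) bounded_linear bounded_linear_submod.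

Record bop := Bop { bop_fun :> E -> F; _ : bop_fun \in bounded_linear }.

HB.instance Definition _ := [isSub for bop_fun].
HB.instance Definition _ := [Choice of bop by <:].
HB.instance Definition _ := [SubChoice_isSubLmodule of bop by <:].

Lemma bop_linear (T : bop) : linear T.
Proof. by case: T => f /= /asboolP[]. Qed.

HB.instance Definition _ (T : bop) :=
  GRing.isLinear.Build K E F _ (bop_fun T) (bop_linear T).

Lemma bop_bounded (T : bop) :
  exists M : R, forall x, rnorm (T x) <= M * rnorm x.
Proof. by case: T => f /= /asboolP[]. Qed.

Definition opnorm (T : bop) : R :=
  sup [set rnorm (T x) | x in [set x : E | rnorm x <= 1]].

Lemma opnorm_has_sup (T : bop) :
  has_sup [set rnorm (T x) | x in [set x : E | rnorm x <= 1]].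
Proof.
split; first by exists (rnorm (T 0)), 0 => //=; rewrite rnorm0 ler01.
have [M TM] := bop_bounded T; exists `|M| => _ [x /= x1 <-].
apply: le_trans (TM x) _; apply: (@le_trans _ _ (`|M| * rnorm x)).
  by rewrite ler_wpM2r ?rnorm_ge0 ?ler_norm.
by rewrite ler_piMr.
Qed.

Lemma opnorm_ub (T : bop) x : rnorm x <= 1 -> rnorm (T x) <= opnorm T.
Proof.
by move=> x1; apply: ub_le_sup; [case: (opnorm_has_sup T)|exists x].
Qed.

Lemma opnorm_le (T : bop) M :
  (forall x, rnorm x <= 1 -> rnorm (T x) <= M) -> opnorm T <= M.
Proof.
move=> TM; apply: ge_sup; first by case: (opnorm_has_sup T).
by move=> _ [x /= /TM ? <-].
Qed.

Lemma opnorm_ge0 (T : bop) : 0 <= opnorm T.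
Proof. by apply: le_trans (opnorm_ub T (x := 0) _); rewrite ?rnorm0 ?rnorm_ge0. Qed.

Lemma opnormP (T : bop) x : rnorm (T x) <= opnorm T * rnorm x.
Proof.
have [/rnorm0_eq0 ->|x0] := eqVneq (rnorm x) 0.
  by rewrite linear0 !rnorm0 mulr0.
have x_gt0 : 0 < rnorm x by rewrite lt0r x0 rnorm_ge0.
have Kx : rnorm (ofReal s (rnorm x)^-1 : K) = (rnorm x)^-1.
  rewrite /rnorm ger0_norm ?ofRealK // -ofReal0 ler_ofReal invr_ge0.
  exact: rnorm_ge0.
rewrite -ler_pdivrMr // mulrC -Kx -rnormZ -linearZ; apply: opnorm_ub.
by rewrite rnormZ Kx mulVf.
Qed.

Let norm (T : bop) : K := ofReal s (opnorm T).

Let norm_triangle T U : norm (T + U) <= norm T + norm U.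
Proof.
rewrite -ofRealD ler_ofReal; apply: opnorm_le => x x1.
by apply: le_trans (rnormD _ _) _; apply: lerD; apply: opnorm_ub.
Qed.

Let opnormZ_le (a : K) T : opnorm (a *: T) <= rnorm a * opnorm T.
Proof.
apply: opnorm_le => x x1; rewrite /= rnormZ ler_wpM2l ?opnorm_ub //.
exact: (@rnorm_ge0 R s K^o).
Qed.

Let normZ (a : K) T : norm (a *: T) = `|a| * norm T.
Proof.
rewrite -[`|a|](ofReal_norm (s := s)) -ofRealM; congr (ofReal s _).
apply/le_anti/andP; split; first exact: opnormZ_le.
have [->|a0] := eqVneq a 0.
  by rewrite normr0 -ofReal0 ofRealK mul0r opnorm_ge0.
have a_gt0 : 0 < rnorm (a : K^o).
  rewrite lt0r (@rnorm_ge0 R s K^o) andbT; apply: contraNneq a0.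
  by move=> /rnorm0_eq0 ->.
rewrite mulrC -ler_pdivlMr // mulrC.
have aV : (rnorm (a : K^o))^-1 = rnorm (a^-1 : K^o).
  apply: (mulfI (lt0r_neq0 a_gt0)); rewrite mulfV ?lt0r_neq0 //.
  rewrite -[LHS](ofRealK (s := s)) -(@rnormZ R s K^o).
  by rewrite /rnorm /GRing.scale /= mulfV // normr1; case: (s).
rewrite aV; apply: le_trans (opnormZ_le _ _).
by rewrite scalerA mulVf // scale1r.
Qed.

Let norm0_eq0 T : norm T = 0 -> T = 0.
Proof.
rewrite -ofReal0 => /(can_inj (@ofRealK R s)) T0; apply/val_inj/funext => x.
apply/rnorm0_eq0/le_anti; rewrite rnorm_ge0 andbT.
by have := opnormP T x; rewrite T0 mul0r.
Qed.

HB.instance Definition _ :=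
  Lmodule_isNormed.Build K bop norm_triangle normZ norm0_eq0.

Lemma rnorm_bop (T : bop) : rnorm T = opnorm T.
Proof. exact: ofRealK. Qed.

End bounded_operators.

Definition dual (R : realType) (s : scalars)
    (E : normedModType (scalarField R s)) :=
  bop E (scalarField R s)^o.

HB.instance Definition _ R s E := NormedModule.on (@dual R s E).

Definition separable_space (T : topologicalType) :=
  exists2 D : set T, countable D & dense D.

Record linSubspace (K : numFieldType) (V : lmodType K) := LinSubspace {
  linSubspace_set :> set V;
  linSubspace0 : linSubspace_set 0;
  linSubspaceP : forall a u v,
    linSubspace_set u -> linSubspace_set v -> linSubspace_set (a *: u + v) }.

Section subspace_module.
Variables (K : numFieldType) (V : lmodType K) (W : linSubspace V).

Definition linSubspace_pred : {pred V} := [pred x | `[< linSubspace_set W x >]].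

Lemma linSubspace_pred_submod : submod_closed linSubspace_pred.
Proof.
split=> [|a u v /asboolP Wu /asboolP Wv]; apply/asboolP.
  exact: linSubspace0.
exact: linSubspaceP.
Qed.

HB.instance Definition _ :=
  GRing.isSubmodClosed.Build K V linSubspace_pred linSubspace_pred_submod.

Record linSubspace_type := LinSubspaceElt {
  linSubspace_val : V;
  _ : linSubspace_val \in linSubspace_pred }.

HB.instance Definition _ := [isSub for linSubspace_val].
HB.instance Definition _ := [Choice of linSubspace_type by <:].
HB.instance Definition _ := [SubChoice_isSubLmodule of linSubspace_type by <:].

End subspace_module.

Section subspace_norm.
Variables (K : numFieldType) (V : normedModType K) (W : linSubspace V).

Let norm (x : linSubspace_type W) : K := `|val x|.

Let norm_triangle x y : norm (x + y) <= norm x + norm y.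
Proof. exact: ler_normD. Qed.

Let normZ (a : K) x : norm (a *: x) = `|a| * norm x.
Proof. exact: normrZ. Qed.

Let norm0_eq0 x : norm x = 0 -> x = 0.
Proof. by move=> /normr0_eq0 x0; apply: val_inj. Qed.

HB.instance Definition _ :=
  Lmodule_isNormed.Build K (linSubspace_type W) norm_triangle normZ norm0_eq0.

End subspace_norm.

Section dimension.
Variables (K : numFieldType) (V : lmodType K).

Definition is_basis (n : nat) (b : 'I_n -> V) :=
  forall v, exists! c : 'rV[K]_n, v = \sum_(i < n) c 0 i *: b i.

Definition has_dim (n : nat) := exists b : 'I_n -> V, is_basis b.

Definition finite_dim := exists n, has_dim n.

End dimension.

Section finite_rank.
Context {R : realType} {s : scalars}.
Local Notation K := (scalarField R s).
Variables E F : normedModType K.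

Definition range_subspace (T : bop E F) : linSubspace F.
Proof.
refine (@LinSubspace K F (range T) _ _); first by exists 0 => //; rewrite linear0.
by move=> a _ _ [x _ <-] [y _ <-]; exists (a *: x + y) => //; rewrite linearP.
Defined.

Definition finite_rank (T : bop E F) :=
  finite_dim (linSubspace_type (range_subspace T)).

End finite_rank.

Section lp.
Context {R : realType} {p : R}.

Definition lp (s : scalars) (p1 : 1 <= p) (n : nat) := 'rV[scalarField R s]_n.

Variables (s : scalars) (p1 : 1 <= p) (n : nat).
Local Notation K := (scalarField R s).
Local Notation ty := (lp s p1 n).

HB.instance Definition _ := GRing.Lmodule.copy ty 'rV[K]_n.

Definition lp_norm (x : ty) : R := (\sum_(i < n) rnorm (x 0 i) `^ p) `^ p^-1.

Let p_gt0 : 0 < p. Proof. exact: lt_le_trans p1. Qed.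
Let p_neq0 : p != 0. Proof. exact: lt0r_neq0. Qed.

Let sum_ge0 (x : ty) : 0 <= \sum_(i < n) rnorm (x 0 i) `^ p.
Proof. by apply: sumr_ge0 => i _; exact: powR_ge0. Qed.

Let rn_ge0 (a : K) : 0 <= rnorm a.
Proof. exact: (@rnorm_ge0 R s K^o). Qed.

Let lp_normK (x : ty) : lp_norm x `^ p = \sum_(i < n) rnorm (x 0 i) `^ p.
Proof. by rewrite -powRrM mulVf // powRr1. Qed.

Lemma lp_norm_ge0 (x : ty) : 0 <= lp_norm x.
Proof. exact: powR_ge0. Qed.

Lemma lp_norm0_eq0 (x : ty) : lp_norm x = 0 -> x = 0.
Proof.
move=> x0; have := lp_normK x; rewrite x0 powR0 // => /esym /eqP.
rewrite psumr_eq0 => [/allP xi0|i _]; last exact: powR_ge0.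
apply/rowP => i; rewrite mxE; apply: (@rnorm0_eq0 R s K^o).
have := xi0 i (mem_index_enum i); rewrite /= powR_eq0 p_neq0 andbT.
by move/eqP.
Qed.

Lemma lp_normZ (a : K) (x : ty) : lp_norm (a *: x) = rnorm a * lp_norm x.
Proof.
rewrite /lp_norm; under eq_bigr => i _ do
  rewrite mxE (@rnormZ R s K^o) powRM //.
by rewrite -mulr_sumr powRM ?powR_ge0 // -powRrM mulfV // powRr1.
Qed.

Lemma lp_normD (x y : ty) : lp_norm (x + y) <= lp_norm x + lp_norm y.
Proof.
have [/lp_norm0_eq0 ->|x0] := eqVneq (lp_norm x) 0.
  by rewrite add0r lerDr lp_norm_ge0.
have [/lp_norm0_eq0 ->|y0] := eqVneq (lp_norm y) 0.
  by rewrite addr0 lerDl lp_norm_ge0.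
have := lp_norm_ge0 y; have := lp_norm_ge0 x.
move aE : (lp_norm x) x0 => a x0; move bE : (lp_norm y) y0 => b y0 a_ge0 b_ge0.
have a_gt0 : 0 < a by rewrite lt0r x0.
have b_gt0 : 0 < b by rewrite lt0r y0.
have ab_gt0 : 0 < a + b by exact: addr_gt0.
have ab_neq0 := lt0r_neq0 ab_gt0.
have t0 : 0 <= a / (a + b) by rewrite divr_ge0 // ltW.
have t1 : a / (a + b) <= 1 by rewrite ler_pdivrMr // mul1r lerDl ltW.
have tE : 1 - a / (a + b) = b / (a + b).
  by apply/esym/(canRL (addrK _)); rewrite addrC -mulrDl divff.
have step i : rnorm ((x + y) 0 i) `^ p <= (a + b) `^ p *
    (a / (a + b) * (rnorm (x 0 i) / a) `^ p +
     b / (a + b) * (rnorm (y 0 i) / b) `^ p).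
  have xa : 0 <= rnorm (x 0 i) / a by rewrite divr_ge0 // ltW.
  have yb : 0 <= rnorm (y 0 i) / b by rewrite divr_ge0 // ltW.
  have := convex_powR p1 (Itv01 t0 t1) (x := rnorm (x 0 i) / a)
    (y := rnorm (y 0 i) / b).
  rewrite !inE /= !in_itv /= !andbT => /(_ xa yb).
  rewrite convRE [X in X `^ _ <= _ -> _]convRE /= /unstable.onem tE => cvx.
  apply: le_trans (ler_wpM2l (powR_ge0 (a + b) p) cvx).
  rewrite -powRM ?(ltW ab_gt0) //; last first.
    by rewrite addr_ge0 // mulr_ge0 // divr_ge0 // ltW.
  have -> : (a + b) * (a / (a + b) * (rnorm (x 0 i) / a) +
      b / (a + b) * (rnorm (y 0 i) / b)) = rnorm (x 0 i) + rnorm (y 0 i).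
    by field; rewrite x0 y0 ab_neq0.
  rewrite ge0_ler_powR ?nnegrE ?addr_ge0 ?(ltW p_gt0) // mxE.
  exact: (@rnormD R s K^o).
have norm1 (z : ty) c : 0 < c -> lp_norm z = c ->
    \sum_(i < n) (rnorm (z 0 i) / c) `^ p = 1.
  move=> c0 cz; under eq_bigr => i _ do rewrite powRM ?invr_ge0 ?(ltW c0) //.
  rewrite -mulr_suml -lp_normK cz -powRM ?invr_ge0 ?(ltW c0) //.
  by rewrite divff ?lt0r_neq0 // powR1.
rewrite [leRHS](_ : _ = ((a + b) `^ p) `^ p^-1); last first.
  by rewrite -powRrM mulfV // powRr1 // ltW.
rewrite ge0_ler_powR ?nnegrE ?invr_ge0 ?powR_ge0 ?(ltW p_gt0) ?sum_ge0 //.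
apply: le_trans (ler_sum _ (fun i _ => step i)) _.
rewrite -mulr_sumr big_split /= -!mulr_sumr !norm1 //.
by rewrite !mulr1 -mulrDl divff // mulr1.
Qed.

Let norm (x : ty) : K := ofReal s (lp_norm x).

Let norm_triangle x y : norm (x + y) <= norm x + norm y.
Proof. by rewrite -ofRealD ler_ofReal lp_normD. Qed.

Let normZ (a : K) x : norm (a *: x) = `|a| * norm x.
Proof. by rewrite /norm lp_normZ ofRealM ofReal_norm. Qed.

Let norm0_eq0 x : norm x = 0 -> x = 0.
Proof. by rewrite -ofReal0 => /(can_inj (@ofRealK R s)) /lp_norm0_eq0. Qed.

HB.instance Definition _ :=
  Lmodule_isNormed.Build K ty norm_triangle normZ norm0_eq0.

Lemma rnorm_lp (x : ty) : rnorm x = lp_norm x.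
Proof. exact: ofRealK. Qed.

End lp.

Section banach_spaces.
Context {R : realType} {s : scalars}.
Local Notation K := (scalarField R s).

(* The infimum is +oo when X and Y are not isomorphic. *)
Definition dBM (X Y : normedModType K) : \bar R :=
  ereal_inf [set d | exists (T : bop X Y) (U : bop Y X),
    [/\ cancel T U, cancel U T & d = (rnorm T * rnorm U)%:E]].

Definition Lp1plus (p : R) (p1 : 1 <= p) (F : normedModType K) :=
  forall eps : R, 0 < eps ->
  forall H : linSubspace F, finite_dim (linSubspace_type H) ->
  exists (G : linSubspace F) (n : nat),
    [/\ has_dim (linSubspace_type G) n, H `<=` G &
        (dBM (linSubspace_type G) (lp s p1 n) < (1 + eps)%:E)%E].

(* The first disjunct is the convention that Z = {0} has the UBCP. *)
Definition UBCP (Z : normedModType K) :=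
  (forall x : Z, x = 0) \/
  exists (r : R) (z : nat -> Z),
    [/\ 0 < r,
        [set x | rnorm x = 1] `<=` \bigcup_j ball (z j) (ofReal s r) &
        r < inf (range (fun j => rnorm (z j)))].

End banach_spaces.

(* Main.v *)
Require Import Defs.
From mathcomp Require Import all_boot all_order all_algebra.
From mathcomp Require Import complex ring lra.
From mathcomp Require Import all_classical all_reals all_analysis.

Set Implicit Arguments.
Unset Strict Implicit.
Unset Printing Implicit Defensive.

Import Order.TTheory GRing.Theory Num.Theory.
Import numFieldNormedType.Exports.

Local Open Scope classical_set_scope.
Local Open Scope ring_scope.

(** Every T of norm 1 is closer to a suitable finite-rank operator S than the norm
    of S, by a fixed margin.  Let y = T x have norm almost 1, with x in the unit
    ball.  Suppose that A is a finite-rank operator on F with A y close to y and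
    ||A - t I|| <= rho, where t > 0 and rho < 1 depend on F only.  Then
    S = t^-1 A T satisfies ||T - S|| <= rho / t, whereas ||S|| >= t^-1 ||A y||
    is at least almost 1 / t ([tensor_approximation_unit_operators]).  As S is a
    finite sum of operators f(.) y with f in the separable dual of E and y in
    the separable space F, countably many such sums suffice as centres
    ([UBCP_of_tensor_approximation]).

    To find A ([finite_rank_near_scaled_identity]), use that F is uniformly
    convex ([Lp1plus_uniformly_convex]) and has finite-rank contractions P that
    almost fix any given finite set ([finite_rank_contraction]).  Choose P1
    almost fixing y, then P2 almost fixing y and the range of P1, and let
    A = (P1 + P2) / 2.  Let u be in the unit ball.  If ||A u|| stays below
    1 by a margin, so does ||A u - t u|| for small t.  Otherwise uniform convexity makes
    P1 u and P2 u close to each other; moreover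
    ||u + P1 u|| >= ||P2 u + P2 P1 u||, which is about 2 ||A u||, so u is close
    to P1 u as well.  Thus A u is close to u and ||A u - t u|| is at most about
    1 - t/2.

    The contractions come from averaging.  In l_p^N, given finitely many
    vectors h_i, group the coordinates by the approximate values of the ratios
    h_i / (|h_1| + ... + |h_M|) and average over each class with the
    corresponding weights.  This is a contraction that almost fixes every h_i
    and whose rank is bounded independently of N ([lp_local_approximation]).
    It carries over to all finite-dimensional subspaces of F, and an ultrafilter
    on them produces one operator on F: the coordinate functionals converge
    pointwise, and the vectors are replaced by a limit of their convex
    combinations, which exists by uniform convexity and completeness
    ([midpoint_base_almost_common_point], [ultra_limit_operator]). *)

(** * Convexity of powers *)

Section power_function.
Context {R : realType}.
Implicit Types a b m p t x y : R.

(** With z = ln a, apply the strict inequality 1 + x < exp x at x = (p - 1) z and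
    at x = - z. *)
Lemma powR_bernoulli_lt p a : 1 < p -> 0 <= a -> a != 1 ->
  1 + p * (a - 1) < a `^ p.
Proof.
move=> p1; have p0 : 0 < p by exact: lt_trans p1.
rewrite le_eqVlt => /predU1P[<- _|a0 a1].
  by rewrite powR0 ?lt0r_neq0 //; lra.
set z := ln a.
have z0 : z != 0 by rewrite ln_eq0.
have az : a = expR z by rewrite lnK.
have apz : a `^ p = expR z * expR ((p - 1) * z).
  by rewrite /powR gt_eqF // -expRD; congr expR; rewrite -/z; ring.
have pz0 : (p - 1) * z != 0 by rewrite mulf_neq0 // subr_eq0 gt_eqF.
have e1 := expR_gt1Dx pz0.
have e2 : 1 + - z < expR (- z) by apply: expR_gt1Dx; rewrite oppr_eq0.
have e3 : expR z * expR (- z) = 1 by rewrite -expRD subrr expR0.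
have ez : 0 < expR z := expR_gt0 z.
rewrite -(ltr_pM2l ez) in e1; rewrite -(ltr_pM2l ez) e3 in e2.
rewrite apz az.
have : (p - 1) * (expR z * (1 + - z)) < (p - 1) * 1 by rewrite ltr_pM2l // subr_gt0.
lra.
Qed.

Lemma powR_bernoulli p a : 1 < p -> 0 <= a -> 1 + p * (a - 1) <= a `^ p.
Proof.
move=> p1 a0; have [->|a1] := eqVneq a 1; first by rewrite powR1; lra.
exact/ltW/powR_bernoulli_lt.
Qed.

Lemma powR_tangent p a b : 1 < p -> 0 <= a -> 0 <= b ->
  b `^ p + p * b `^ (p - 1) * (a - b) <= a `^ p.
Proof.
move=> p1 a0; rewrite le_eqVlt => /predU1P[<-|b0].
  rewrite !powR0 ?mulr0 ?mul0r ?addr0 ?powR_ge0 //.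
    by rewrite subr_eq0 gt_eqF.
  by rewrite gt_eqF // (lt_trans _ p1).
have bp : b `^ p = b * b `^ (p - 1).
  by rewrite mulr_powRB1 ?ltW // (lt_trans _ p1).
have ab : 0 <= a / b by rewrite divr_ge0 // ltW.
have := powR_bernoulli p1 ab.
rewrite -(ler_pM2l (powR_gt0 p b0)) -powRM ?(ltW b0) //.
rewrite [b * (a / b)]mulrC divfK ?gt_eqF //.
apply: le_trans; rewrite bp le_eqVlt; apply/orP; left; apply/eqP.
by field; rewrite gt_eqF.
Qed.

(** Let m = (1 + x) / 2.  The points 1 / m and x / m have mean 1, so the Bernoulli
    inequality at both points bounds the midpoint defect divided by m^p from
    below by half of the Bernoulli defect at 1 / m, which increases with 1 / m >= 2 / (1 + t). *)
Lemma powR_midpoint_gap p t : 1 < p -> t < 1 -> exists2 c : R, 0 < c &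
  forall x, 0 <= x -> x <= t -> ((1 + x) / 2) `^ p + c <= (1 + x `^ p) / 2.
Proof.
move=> p1 t1; have p0 : 0 < p by exact: lt_trans p1.
have [t0|t0] := leP 0 t; last first.
  by exists 1 => // x x0 xt; have := le_lt_trans xt t0; rewrite ltNge x0.
pose y := 2 / (1 + t).
have y1 : 1 < y by rewrite /y ltr_pdivlMr; lra.
pose gap := y `^ p - (1 + p * (y - 1)).
have gap0 : 0 < gap.
  by rewrite subr_gt0 powR_bernoulli_lt // ?gt_eqF //; lra.
exists ((2^-1) `^ p * gap / 2) => [|x x0 xt].
  by rewrite divr_gt0 // mulr_gt0 // powR_gt0 // invr_gt0.
pose m := (1 + x) / 2.
have m0 : 0 < m by rewrite /m; lra.
have mp0 : 0 < m `^ p := powR_gt0 p m0.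
have half_m : (2^-1) `^ p <= m `^ p.
  by rewrite ge0_ler_powR ?nnegrE ?(ltW p0) ?invr_ge0 // /m; lra.
have ym : y <= m^-1.
  rewrite /y /m invf_div ler_pM2l // lef_pV2 ?posrE; lra.
have gap_m : gap <= (m^-1) `^ p - (1 + p * (m^-1 - 1)).
  have y0 : 0 <= y := ltW (lt_trans ltr01 y1).
  have yt := powR_tangent p1 (le_trans y0 ym) y0.
  have yp : 1 <= y `^ (p - 1).
    by rewrite -{1}(powRr0 y) ler_powR ?(ltW y1) // subr_ge0 ltW.
  have : p * 1 * (m^-1 - y) <= p * y `^ (p - 1) * (m^-1 - y).
    by rewrite ler_wpM2r ?subr_ge0 // ler_pM2l.
  by rewrite /gap; lra.
have xm0 : 0 <= x / m by rewrite divr_ge0 // ltW.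
have xm := powR_bernoulli p1 xm0.
have mV : m^-1 + x / m = 2.
  by rewrite /m; field; rewrite gt_eqF //; lra.
have key : gap + 2 <= (m^-1) `^ p + (x / m) `^ p.
  have -> : 2 = (1 + p * (m^-1 - 1)) + (1 + p * (x / m - 1)).
    have -> : x / m = 2 - m^-1 by apply/eqP; rewrite eq_sym subr_eq addrC mV.
    by ring.
  by lra.
have mpV : m `^ p * (m^-1) `^ p = 1.
  by rewrite -powRM ?invr_ge0 ?(ltW m0) // divff ?gt_eqF // powR1.
have mpx : m `^ p * (x / m) `^ p = x `^ p.
  by rewrite -powRM ?(ltW m0) // mulrC divfK ?gt_eqF.
clearbody gap.
have : m `^ p * (gap + 2) <= m `^ p * ((m^-1) `^ p + (x / m) `^ p).
  by rewrite ler_pM2l.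
rewrite !mulrDr mpV mpx -/m.
have : (2^-1) `^ p * gap <= m `^ p * gap by rewrite ler_pM2r.
lra.
Qed.

Lemma mulr_div1D_le (c e : R) : 0 <= c -> 0 <= e -> c * (e / (c + 1)) <= e.
Proof.
move=> c0 e0; rewrite mulrCA ler_piMr // ler_pdivrMr ?ltr_wpDl //.
by rewrite mul1r lerDl.
Qed.

End power_function.

(** * Scalars and norms *)

Lemma rnorm_complex (R : realType) (z : scalarField R ComplexScalars) :
  rnorm z = Num.sqrt (complex.Re (z : R[i]) ^+ 2 + complex.Im (z : R[i]) ^+ 2).
Proof. by have /(congr1 (@complex.Re R)) := normc_def z. Qed.

Section scalars.
Context {R : realType} {s : scalars}.
Local Notation K := (scalarField R s).
Implicit Types (a b z : K) (e p t x y : R).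

Lemma ltr_ofReal x y : (ofReal s x < ofReal s y) = (x < y).
Proof. by case: s => //=; rewrite ltcR. Qed.

Lemma rnorm_ofReal x : rnorm (ofReal s x) = `|x|.
Proof.
case: s => [//|].
by rewrite rnorm_complex /= expr0n /= addr0 sqrtr_sqr.
Qed.

Lemma ofReal1 : ofReal s (1 : R) = 1.
Proof. by case: s. Qed.

Lemma scalar_rnorm_ge0 a : 0 <= rnorm a.
Proof. exact: (@rnorm_ge0 R s K^o). Qed.

Lemma scalar_rnormD a b : rnorm (a + b) <= rnorm a + rnorm b.
Proof. exact: (@rnormD R s K^o). Qed.

Lemma scalar_rnormM a b : rnorm (a * b) = rnorm a * rnorm b.
Proof. exact: (@rnormZ R s K^o). Qed.

Lemma scalar_rnorm0 : rnorm (0 : K) = 0.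
Proof. exact: (@rnorm0 R s K^o). Qed.

Lemma scalar_rnorm1 : rnorm (1 : K) = 1.
Proof.
by rewrite -ofReal1 rnorm_ofReal normr1.
Qed.

Lemma scalar_rnorm_gt0 a : (0 < rnorm a) = (a != 0).
Proof.
rewrite lt0r scalar_rnorm_ge0 andbT; congr negb.
by apply/eqP/eqP => [/(@rnorm0_eq0 R s K^o)|->] //; exact: scalar_rnorm0.
Qed.

Lemma ler_scalar_rnorm_sum (I : Type) (r : seq I) (P : pred I) (F : I -> K) :
  rnorm (\sum_(i <- r | P i) F i) <= \sum_(i <- r | P i) rnorm (F i).
Proof.
elim/big_rec2: _ => [|i x y _ le_xy]; first by rewrite scalar_rnorm0.
by apply: le_trans (scalar_rnormD _ _) _; rewrite lerD2l.
Qed.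

Lemma gt0_ofReal a : 0 < a -> exists2 e : R, 0 < e & a = ofReal s e.
Proof.
move=> a0; have aE : a = ofReal s (rnorm a) by rewrite ofReal_norm gtr0_norm.
by exists (rnorm a) => //; rewrite -ltr_ofReal -aE ofReal0.
Qed.

Lemma scalar_parallelogram a b :
  rnorm (a + b) ^+ 2 + rnorm (a - b) ^+ 2 = 2 * (rnorm a ^+ 2 + rnorm b ^+ 2).
Proof.
move: a b; case: s => [a b|[a1 a2] [b1 b2]].
  by rewrite /rnorm /= !real_normK ?num_real //; ring.
by rewrite !rnorm_complex /= !sqr_sqrtr ?addr_ge0 ?sqr_ge0 //; ring.
Qed.

Lemma powR_midpoint p x y : 1 < p -> 0 <= x -> 0 <= y ->
  ((x + y) / 2) `^ p <= (x `^ p + y `^ p) / 2.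
Proof.
move=> p1 x0 y0; have m0 : 0 <= (x + y) / 2 by lra.
have := powR_tangent p1 x0 m0; have := powR_tangent p1 y0 m0.
set m := _ / 2 in m0 *; set M := m `^ p; set c := p * _.
have -> : y = m + m - x by rewrite /m; field.
rewrite [x - m](_ : _ = - (m + m - x - m)); last by ring.
rewrite mulrN; lra.
Qed.

(** Either |z| is bounded away from 1, and the real inequality for |z| applies, or
    |z| is almost 1, and the parallelogram identity bounds |1 + z|. *)
Lemma scalar_midpoint_gap p e : 1 < p -> 0 < e -> exists2 c, 0 < c &
  forall z, rnorm z <= 1 -> e <= rnorm (1 - z) ->
    (rnorm (1 + z) / 2) `^ p + c <= (1 + rnorm z `^ p) / 2.
Proof.
move=> p1 e0; have p0 : 0 < p by exact: lt_trans p1.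
have e20 : 0 < e ^+ 2 by rewrite exprn_gt0.
(* By the Bernoulli inequality, |z| >= 1 - e^2 / (8 p) implies
   |z|^p >= 1 - e^2 / 8. *)
have t1 : 1 - e ^+ 2 / 8 / p < 1 by rewrite gtrBl !divr_gt0.
have [c c0 gap] := powR_midpoint_gap p1 t1.
exists (Num.min c (e ^+ 2 / 16)) => [|z z1 ez].
  by rewrite lt_min c0 divr_gt0.
have z0 := scalar_rnorm_ge0 z.
have := scalar_rnormD 1 z; rewrite scalar_rnorm1 => z1D.
have u0 : 0 <= rnorm (1 + z) / 2 by rewrite divr_ge0 ?scalar_rnorm_ge0.
have [zt|zt] := leP (rnorm z) (1 - e ^+ 2 / 8 / p).
  apply: le_trans (gap _ z0 zt); rewrite lerD ?ge_min ?lexx //.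
  rewrite ge0_ler_powR ?nnegrE ?(ltW p0) //; lra.
have zp : 1 - e ^+ 2 / 8 <= rnorm z `^ p.
  apply: le_trans (powR_bernoulli p1 z0).
  have : p * (- (e ^+ 2 / 8 / p)) <= p * (rnorm z - 1).
    by rewrite ler_pM2l //; lra.
  have -> : p * - (e ^+ 2 / 8 / p) = - (e ^+ 2 / 8).
    by rewrite mulrN mulrC divfK ?gt_eqF.
  by lra.
have := scalar_parallelogram 1 z; rewrite scalar_rnorm1 => para.
have zz : rnorm z ^+ 2 <= 1 by rewrite expr_le1.
have ee : e ^+ 2 <= rnorm (1 - z) ^+ 2.
  by rewrite ler_pXn2r ?nnegrE ?scalar_rnorm_ge0 // ltW.
have uu : (rnorm (1 + z) / 2) ^+ 2 <= 1 - e ^+ 2 / 4.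
  rewrite expr_div_n; lra.
have ule : rnorm (1 + z) / 2 <= 1 - e ^+ 2 / 8.
  have e4 : e ^+ 2 <= 4.
    have := sqr_ge0 (rnorm (1 + z) / 2); lra.
  rewrite -(@ler_pXn2r _ 2) ?nnegrE //; last by lra.
  by apply: le_trans uu _; have := sqr_ge0 (e ^+ 2 / 8); rewrite sqrrB; lra.
have up : (rnorm (1 + z) / 2) `^ p <= 1 - e ^+ 2 / 8.
  apply: le_trans ule; have [->|u_neq0] := eqVneq (rnorm (1 + z) / 2) 0.
    by rewrite powR0 ?gt_eqF.
  by apply: ge1r_powR (ltW p1); rewrite lt0r u_neq0 u0; lra.
have cm : Num.min c (e ^+ 2 / 16) <= e ^+ 2 / 16 by rewrite ge_min lexx orbT.
lra.
Qed.

(** Uniform convexity of l_p in a form that is additive over coordinates: summing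
    it bounds ||x - y||^p by the midpoint defect, with constants independent of
    the dimension. By homogeneity one may take a = 1 and |b| <= 1. *)
Lemma scalar_uniform_convexity p e : 1 < p -> 0 < e -> exists2 C, 0 <= C &
  forall a b, rnorm (a - b) `^ p <= e * (rnorm a `^ p + rnorm b `^ p) +
    C * ((rnorm a `^ p + rnorm b `^ p) / 2 - (rnorm (a + b) / 2) `^ p).
Proof.
move=> p1 e0; have p0 : 0 < p by exact: lt_trans p1.
have e'0 : 0 < e `^ p^-1 by exact: powR_gt0.
have [c c0 gap] := scalar_midpoint_gap p1 e'0.
exists (2 `^ p / c) => [|a b]; first by rewrite divr_ge0 ?powR_ge0 ?ltW.
wlog ba : a b / rnorm b <= rnorm a => [wlog_ab|].
  have [/wlog_ab//|/ltW/wlog_ab] := leP (rnorm b) (rnorm a).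
  have -> : rnorm (b - a) = rnorm (a - b) by rewrite /rnorm distrC.
  by rewrite [b + a]addrC [rnorm b `^ p + _]addrC.
have [a0|a0] := eqVneq a 0.
  move: ba; rewrite a0 scalar_rnorm0 => b0.
  have -> : b = 0.
    by apply/eqP; move: b0; apply: contraTT; rewrite -scalar_rnorm_gt0 ltNge.
  rewrite subr0 addr0 scalar_rnorm0 mul0r powR0 ?gt_eqF //.
  by rewrite !addr0 !mul0r subr0 !mulr0 addr0.
have ra0 : 0 < rnorm a by rewrite scalar_rnorm_gt0.
have [z bE] : exists z, b = a * z by exists (b / a); rewrite mulrC divfK.
have z1 : rnorm z <= 1 by rewrite -(ler_pM2l ra0) -scalar_rnormM mulr1 -bE.
rewrite {b ba}bE.
have -> : a - a * z = a * (1 - z) by rewrite mulrBr mulr1.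
have -> : a + a * z = a * (1 + z) by rewrite mulrDr mulr1.
have N0 := scalar_rnorm_ge0.
rewrite !scalar_rnormM -[_ * _ / 2]mulrA.
rewrite !(powRM _ (N0 a) (N0 _)) (powRM _ (N0 a) (divr_ge0 (N0 _) (ler0n _ 2))).
set A := rnorm a `^ p; have A0 : 0 < A by rewrite powR_gt0.
set Z := rnorm z `^ p; set U := (_ / 2) `^ p; set D := _ `^ p.
suff : D <= e * (1 + Z) + 2 `^ p / c * ((1 + Z) / 2 - U).
  rewrite -(ler_pM2l A0) => /le_trans; apply.
  by rewrite le_eqVlt; apply/orP; left; apply/eqP; ring.
have Z0 : 0 <= Z := powR_ge0 _ _.
have := scalar_rnormD 1 z; rewrite scalar_rnorm1 => z1D.
have [ez|ez] := leP (e `^ p^-1) (rnorm (1 - z)).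
  have D2 : D <= 2 `^ p.
    rewrite ge0_ler_powR ?nnegrE ?(ltW p0) ?N0 //.
    have := scalar_rnormD 1 (- z); rewrite scalar_rnorm1.
    have -> : rnorm (- z) = rnorm z by rewrite /rnorm normrN.
    by lra.
  apply: le_trans D2 _; apply: (@le_trans _ _ (2 `^ p / c * ((1 + Z) / 2 - U))).
    rewrite -mulrA ler_peMr ?powR_ge0 //.
    by rewrite mulrC ler_pdivlMr // mul1r; have := gap _ z1 ez; rewrite -/U -/Z; lra.
  by rewrite lerDr mulr_ge0 ?(ltW e0) //; lra.
have UZ : U <= (1 + Z) / 2.
  apply: le_trans (_ : ((1 + rnorm z) / 2) `^ p <= _).
    rewrite ge0_ler_powR ?nnegrE ?divr_ge0 ?addr_ge0 ?N0 ?(ltW p0) //; lra.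
  by have := powR_midpoint p1 ler01 (N0 z); rewrite powR1.
have De : D <= e.
  rewrite [leRHS](_ : _ = (e `^ p^-1) `^ p); last first.
    by rewrite -powRrM mulVf ?gt_eqF // powRr1 // ltW.
  by rewrite ge0_ler_powR ?nnegrE ?N0 ?(ltW p0) ?(ltW e'0) // ltW.
apply: le_trans De _; rewrite -{1}[e]mulr1 -[leLHS]addr0.
rewrite lerD ?ler_pM2l ?lerDl // mulr_ge0 ?subr_ge0 //.
by rewrite divr_ge0 ?powR_ge0 ?ltW.
Qed.

End scalars.

Section norms.
Context {R : realType} {s : scalars} {V : normedModType (scalarField R s)}.
Local Notation K := (scalarField R s).
Implicit Types (x y z : V) (e : R).

Lemma ball_rnorm x y e :
  ball x (ofReal s e) y = (rnorm (x - y) < e) :> Prop.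
Proof. by rewrite -ball_normE /ball_ /= -rnormE ltr_ofReal. Qed.

Lemma rnormN x : rnorm (- x) = rnorm x.
Proof. by rewrite /rnorm normrN. Qed.

Lemma rnormB x y : rnorm (x - y) = rnorm (y - x).
Proof. by rewrite /rnorm distrC. Qed.

Lemma rnormZr (a : R) x :
  0 <= a -> rnorm (ofReal s a *: x) = a * rnorm x.
Proof. by move=> a0; rewrite rnormZ rnorm_ofReal ger0_norm. Qed.

Lemma rnorm_half x :
  rnorm ((2^-1 : K) *: x) = rnorm x / 2.
Proof.
have -> : (2^-1 : K) = ofReal s 2^-1.
  apply: (mulfI (_ : 2 != 0 :> K)); first by rewrite pnatr_eq0.
  rewrite mulfV ?pnatr_eq0 // -[X in X * _](_ : ofReal s 2 = 2); last first.
    by rewrite -[2]/(1 + 1) ofRealD ofReal1.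
  by rewrite -ofRealM mulfV ?pnatr_eq0 // ofReal1.
by rewrite rnormZr ?invr_ge0 // mulrC.
Qed.

Lemma ler_rnorm_sum (I : Type) (r : seq I) (P : pred I) (F : I -> V) :
  rnorm (\sum_(i <- r | P i) F i) <= \sum_(i <- r | P i) rnorm (F i).
Proof.
elim/big_rec2: _ => [|i x y _ le_xy]; first by rewrite rnorm0.
by apply: le_trans (rnormD _ _) _; rewrite lerD2l.
Qed.

Lemma midpointB x y z :
  (2^-1 : K) *: (x + y) - z = (2^-1 : K) *: ((x - z) + (y - z)).
Proof.
rewrite addrACA -opprD [RHS]scalerDr; congr (_ + _).
by rewrite scalerN -mulr2n -[z *+ 2]scaler_nat scalerA mulVf ?pnatr_eq0 // scale1r.
Qed.

End norms.

(** * Subspaces of finite dimension *)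

Section finite_dimension.
Context {K : numFieldType} {V : lmodType K}.

Definition free_family m (b : 'I_m -> V) :=
  forall c : 'rV[K]_m, \sum_(i < m) c 0 i *: b i = 0 -> c = 0.

Lemma free_family_le m n (b : 'I_m -> V) (g : 'I_n -> V) (C : 'M[K]_(m, n)) :
  free_family b -> (forall i, b i = \sum_(j < n) C i j *: g j) -> (m <= n)%N.
Proof.
move=> b_free bE; rewrite leqNgt; apply/negP => n_lt_m.
have : kermx C != 0.
  rewrite kermx_eq0; apply/negP => /eqP rankC.
  by have := rank_leq_col C; rewrite rankC leqNgt n_lt_m.
case/rowV0Pn => u /sub_kermxP uC /eqP; apply; apply: b_free.
under eq_bigr => i _ do rewrite bE scaler_sumr.
rewrite exchange_big big1 //= => j _.
under eq_bigr => i _ do rewrite scalerA.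
rewrite -scaler_suml; have /rowP/(_ j) := uC; rewrite !mxE => ->.
by rewrite scale0r.
Qed.

Lemma maximal_free_family_basis m (b : 'I_m -> V) : free_family b ->
  (forall b' : 'I_m.+1 -> V, ~ free_family b') -> is_basis b.
Proof.
move=> b_free b_max v.
pose b' (i : 'I_m.+1) := oapp b v (unlift ord0 i).
have [c [cb' c0]] : exists c : 'rV[K]_m.+1,
    \sum_(i < m.+1) c 0 i *: b' i = 0 /\ c <> 0.
  have /existsNP[c /not_implyP] := b_max b'; by exists c.
have b'0 : b' ord0 = v by rewrite /b' unlift_none.
have b'S i : b' (lift ord0 i) = b i by rewrite /b' liftK.
rewrite big_ord_recl b'0 in cb'.
rewrite (eq_bigr (fun i => c 0 (lift ord0 i) *: b i)) in cb'; last first.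
  by move=> i _; rewrite b'S.
have c00 : c 0 ord0 != 0.
  apply: contra_notN c0 => /eqP c00; rewrite c00 scale0r add0r in cb'.
  have /rowP cS : \row_i c 0 (lift ord0 i) = 0.
    by apply: b_free; rewrite -[RHS]cb'; apply: eq_bigr => i _; rewrite mxE.
  apply/rowP => i; rewrite mxE; have [j ->|->] := unliftP ord0 i => //.
  by have := cS j; rewrite !mxE.
pose a : 'rV[K]_m := \row_i (- (c 0 ord0)^-1 * c 0 (lift ord0 i)).
have va : v = \sum_(i < m) a 0 i *: b i.
  under eq_bigr do rewrite mxE -scalerA.
  rewrite -scaler_sumr; apply: (scalerI c00); rewrite scalerA mulrN mulfV //.
  by rewrite scaleN1r; apply/eqP; rewrite -addr_eq0 cb'.
exists a; split => // d vd; apply/eqP; rewrite -subr_eq0; apply/eqP.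
have adE i : (a - d) 0 i = a 0 i - d 0 i by rewrite [LHS]mxE [X in _ + X]mxE.
apply: b_free; under eq_bigr do rewrite adE scalerBl.
by rewrite sumrB -va -vd subrr.
Qed.

End finite_dimension.

(** The sizes of free families in W are bounded by n, and one of maximal size is a
    basis. *)
Lemma finite_dim_in_span (K : numFieldType) (V : lmodType K)
    (W : linSubspace V) n (g : 'I_n -> V) :
  (forall v, (W : set V) v -> exists c : 'rV[K]_n, v = \sum_(i < n) c 0 i *: g i) ->
  finite_dim (linSubspace_type W).
Proof.
move=> Wg; pose T := linSubspace_type W.
have val_sum m (c : 'I_m -> K) (b : 'I_m -> T) :
    val (\sum_i c i *: b i) = \sum_i c i *: val (b i).
  by rewrite raddf_sum; apply: eq_bigr => i _.
pose P m := `[< exists b : 'I_m -> T, free_family b >].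
have P0 : exists m, P m.
  by exists 0%N; apply/asboolP; exists (fun=> 0) => c _; apply/rowP => -[].
have Pn m : P m -> (m <= n)%N.
  move=> /asboolP[b b_free].
  have Wb i : (W : set V) (val (b i)) by have /asboolP := valP (b i).
  have [C bC] := choice (fun i => Wg _ (Wb i)).
  apply: (@free_family_le _ _ _ _ (val \o b) g (\matrix_(i, j) C i 0 j)).
    move=> c cb; apply: b_free; apply: val_inj; rewrite val_sum; exact: cb.
  by move=> i; rewrite /= bC; apply: eq_bigr => j _; rewrite mxE.
have [m /asboolP[b b_free] m_max] := ex_maxnP P0 Pn.
exists m, b; apply: maximal_free_family_basis => // b' b'_free.
have /m_max : P m.+1 by apply/asboolP; exists b'.
by rewrite ltnn.
Qed.

(** Defined transparently, so that membership unfolds to an explicit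
    combination. *)
Definition list_span (K : numFieldType) (V : lmodType K) (l : seq V) : linSubspace V.
Proof.
refine (@LinSubspace K V
  [set v | exists c : 'I_(size l) -> K, v = \sum_i c i *: l`_i] _ _).
  by exists (fun=> 0); rewrite big1 // => i _; rewrite scale0r.
move=> a _ _ [c ->] [d ->]; exists (fun i => a * c i + d i).
rewrite scaler_sumr -big_split; apply: eq_bigr => i _.
by rewrite scalerDl scalerA.
Defined.

Lemma mem_list_span (K : numFieldType) (V : lmodType K) (l : seq V) v :
  v \in l -> (list_span l : set V) v.
Proof.
move=> vl; have il : (index v l < size l)%N by rewrite index_mem.
exists (fun i => (i == Ordinal il)%:R); rewrite (bigD1 (Ordinal il)) //= eqxx.
rewrite scale1r nth_index // big1 ?addr0 // => i /negbTE ->.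
by rewrite scale0r.
Qed.

Lemma finite_dim_list_span (K : numFieldType) (V : lmodType K) (l : seq V) :
  finite_dim (linSubspace_type (list_span l)).
Proof.
apply: (finite_dim_in_span (g := fun i : 'I_(size l) => l`_i)) => v [c ->].
by exists (\row_i c i); apply: eq_bigr => i _; rewrite mxE.
Qed.

(** * Uniform convexity *)

Section uniform_convexity.
Context {R : realType} {s : scalars}.
Local Notation K := (scalarField R s).

Definition uniformly_convex (V : normedModType K) := forall e : R, 0 < e ->
  exists2 d : R, 0 < d & forall x y : V, rnorm x <= 1 -> rnorm y <= 1 ->
    2 * (1 - d) <= rnorm (x + y) -> rnorm (x - y) <= e.

Lemma lp_powR (p : R) (p1 : 1 <= p) n (x : lp s p1 n) :
  rnorm x `^ p = \sum_(i < n) rnorm (x 0 i) `^ p.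
Proof.
have p0 : 0 < p := lt_le_trans ltr01 p1.
rewrite rnorm_lp /lp_norm -powRrM mulVf ?gt_eqF // powRr1 //.
by apply: sumr_ge0 => i _; exact: powR_ge0.
Qed.

Lemma lp_uniformly_convex (p : R) (p1 : 1 < p) (e : R) : 0 < e ->
  exists2 d : R, 0 < d & forall n (x y : lp s (ltW p1) n),
    rnorm x <= 1 -> rnorm y <= 1 -> 2 * (1 - d) <= rnorm (x + y) ->
    rnorm (x - y) <= e.
Proof.
move=> e0; have p0 : 0 < p by exact: lt_trans p1.
have ep : 0 < e `^ p by exact: powR_gt0.
have ep4 : 0 < e `^ p / 4 by exact: divr_gt0.
have [C C0 ineq] := @scalar_uniform_convexity R s p _ p1 ep4.
have [d d0 dC] : exists2 d, 0 < d & C * (p * d) <= e `^ p / 2.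
  have Cp : 0 <= C * p by rewrite mulr_ge0 // ltW.
  exists (e `^ p / 2 / (C * p + 1)); first by rewrite !divr_gt0 // ltr_wpDl.
  by rewrite (mulrA C p) mulr_div1D_le // divr_ge0 ?powR_ge0.
exists d => // n x y x1 y1 xy.
have le1 (z : lp s (ltW p1) n) : rnorm z <= 1 -> \sum_i rnorm (z 0 i) `^ p <= 1.
  move=> z1; have <- : 1 `^ p = 1 :> R by rewrite powR1.
  rewrite -lp_powR.
  by rewrite ge0_ler_powR ?nnegrE ?rnorm_ge0 ?ler01 ?(ltW p0).
have big_mid : 1 - p * d <= \sum_i (rnorm (x 0 i + y 0 i) / 2) `^ p.
  have m0 : 0 <= rnorm (x + y) / 2 by rewrite divr_ge0 ?rnorm_ge0.
  apply: (@le_trans _ _ ((rnorm (x + y) / 2) `^ p)).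
    apply: le_trans (powR_bernoulli p1 m0).
    have : - (p * d) <= p * (rnorm (x + y) / 2 - 1).
      have dr : - d <= rnorm (x + y) / 2 - 1.
        by move: (rnorm (x + y)) xy; clear => r xy; lra.
      by rewrite -mulrN; exact: ler_wpM2l (ltW p0) _ _ dr.
    by rewrite lerD2l.
  rewrite powRM ?rnorm_ge0 ?invr_ge0 // lp_powR mulr_suml ler_sum // => i _.
  by rewrite mxE powRM ?scalar_rnorm_ge0 ?invr_ge0.
suff : rnorm (x - y) `^ p <= e `^ p.
  move=> le_p; rewrite leNgt; apply/negP => lt_e; move: le_p; apply/negP.
  by rewrite -ltNge gt0_ltr_powR ?nnegrE ?rnorm_ge0 ?(ltW e0).
rewrite lp_powR; under eq_bigr do rewrite !mxE.
apply: le_trans (ler_sum _ (fun i _ => ineq (x 0 i) (y 0 i))) _.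
rewrite big_split /= -!mulr_sumr big_split /= sumrB -mulr_suml big_split /=.
set X := \sum_i _; set Y := \sum_i _; set M := \sum_i _.
have X1 : X <= 1 := le1 _ x1; have Y1 : Y <= 1 := le1 _ y1.
move: big_mid; rewrite -/M; clearbody X Y M => big_mid.
have b1 : e `^ p / 4 * (X + Y) <= e `^ p / 4 * 2.
  by rewrite (ler_pM2l ep4); clear - X1 Y1; lra.
have b2 : C * ((X + Y) / 2 - M) <= C * (p * d).
  by apply: ler_wpM2l => //; clear - big_mid X1 Y1; lra.
move: b1 b2 dC; clear; lra.
Qed.

Lemma bounded_linear_mem (V W : normedModType K) (f : V -> W) (M : R) :
  linear f -> (forall x, rnorm (f x) <= M * rnorm x) ->
  f \in bounded_linear (E := V) (F := W).
Proof. by move=> lf fM; apply/asboolP; split=> //; exists M. Qed.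

(** The isomorphism between a subspace containing H and l_p^n, read between F and
    l_p^n so that no subspace types remain; it is rescaled to make T a
    contraction. *)
Lemma Lp1plus_local (p : R) (p1 : 1 <= p) (F : normedModType K)
    (H : linSubspace F) (e : R) : Lp1plus p1 F -> 0 < e ->
  finite_dim (linSubspace_type H) ->
  exists n (T : F -> lp s p1 n) (U : bop (lp s p1 n) F),
    [/\ forall (a : K) u v, (H : set F) u -> (H : set F) v ->
          T (a *: u + v) = a *: T u + T v,
        forall u, (H : set F) u -> U (T u) = u,
        forall u, (H : set F) u -> rnorm (T u) <= rnorm u &
        forall x, rnorm (U x) <= (1 + e) * rnorm x].
Proof.
move=> Fp e0 /(Fp e e0 H)[G [n [_ HG]]].
case/ereal_inf_lt => _ [T [U [TK _ ->]]]; rewrite lte_fin !rnorm_bop => TU.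
have c0 := opnorm_ge0 T; set c := opnorm T in TU c0.
pose sub (u : F) : linSubspace_type G := insubd 0 u.
have subK u : (H : set F) u -> val (sub u) = u.
  by move=> /HG Gu; rewrite insubdK //; apply/asboolP.
pose T' u := ofReal s c^-1 *: T (sub u).
pose U' x := ofReal s c *: val (U x).
have U'_lin : linear U'.
  move=> a x y; rewrite /U' (bop_linear U).
  rewrite -[val (_ + _)]/(a *: val (U x) + val (U y)) scalerDr !scalerA.
  by rewrite [a * _]mulrC.
have U'_bound x : rnorm (U' x) <= (1 + e) * rnorm x.
  rewrite rnormZ rnorm_ofReal ger0_norm //.
  apply: le_trans (ler_wpM2l c0 (opnormP U x)) _.
  by rewrite mulrA ler_wpM2r ?rnorm_ge0 // ltW.
exists n, T', (Bop (bounded_linear_mem U'_lin U'_bound)).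
split=> //= [a u v Hu Hv|u Hu|u Hu].
- rewrite /T'; have -> : sub (a *: u + v) = a *: sub u + sub v.
    apply: val_inj; rewrite subK; last exact: linSubspaceP.
    by rewrite -[RHS]/(a *: val (sub u) + val (sub v)) !subK.
  by rewrite (bop_linear T) scalerDr !scalerA mulrC.
- have UZ (a : K) y : val (U (a *: y)) = a *: val (U y).
    by have /= := bop_linear U a y 0; rewrite linear0 !addr0 => ->.
  rewrite /U' /T' UZ TK subK // scalerA -ofRealM.
  have [c_eq0|c_neq0] := eqVneq c 0; last first.
    by rewrite mulfV // ofReal1 scale1r.
  have := opnormP T (sub u); rewrite -/c c_eq0 mul0r => Tu0.
  have /rnorm0_eq0 Tu : rnorm (T (sub u)) = 0.
    by apply/le_anti; rewrite Tu0 rnorm_ge0.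
  by rewrite mul0r ofReal0 scale0r -(subK u Hu) -(TK (sub u)) Tu linear0.
- rewrite rnormZ rnorm_ofReal ger0_norm ?invr_ge0 //.
  apply: le_trans (ler_wpM2l _ (opnormP T _)) _; first by rewrite invr_ge0.
  rewrite mulrA -/c; have -> : rnorm (sub u) = rnorm u by rewrite -{2}(subK u Hu).
  have [->|c_neq0] := eqVneq c 0; first by rewrite mulr0 mul0r rnorm_ge0.
  by rewrite mulVf // mul1r.
Qed.

(** Uniform convexity involves two vectors at a time, and these lie in a common
    almost isometric copy of l_p^n. *)
Lemma Lp1plus_uniformly_convex (p : R) (p1 : 1 < p) (F : normedModType K) :
  Lp1plus (ltW p1) F -> uniformly_convex F.
Proof.
move=> Fp e e0; have e2 : 0 < e / 2 by exact: divr_gt0.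
have [d d0 lp_uc] := lp_uniformly_convex p1 e2.
exists (d / 2) => [|x y x1 y1 xy]; first exact: divr_gt0.
pose H := list_span [:: x; y].
have Hx : (H : set F) x by apply: mem_list_span; rewrite !inE eqxx.
have Hy : (H : set F) y by apply: mem_list_span; rewrite !inE eqxx orbT.
have e'0 : 0 < Num.min 1 (d / 2) by rewrite lt_min ltr01 divr_gt0.
have [n [T [U [T_lin TK T1 U1]]]] :=
  Lp1plus_local Fp e'0 (finite_dim_list_span [:: x; y]).
set e' := Num.min _ _ in e'0 U1.
have e'1 : e' <= 1 by rewrite ge_min lexx.
have e'd : e' <= d / 2 by rewrite ge_min lexx orbT.
have TD : T (x + y) = T x + T y by have := T_lin 1 x y Hx Hy; rewrite !scale1r.
have TB : T (x - y) = T x - T y.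
  by have := T_lin (-1) y x Hy Hx; rewrite !scaleN1r addrC [RHS]addrC.
have HD : (H : set F) (x + y).
  by have := linSubspaceP 1 Hx Hy; rewrite scale1r.
have HB : (H : set F) (x - y).
  by have := linSubspaceP (-1) Hy Hx; rewrite scaleN1r addrC.
have xyT : rnorm (x + y) <= (1 + e') * rnorm (T x + T y).
  by rewrite -TD -{1}(TK _ HD).
have Txy : rnorm (T x - T y) <= e / 2.
  apply: lp_uc; [exact: le_trans (T1 _ Hx) x1|exact: le_trans (T1 _ Hy) y1|].
  rewrite leNgt; apply/negP => lt_d.
  have e'1_gt0 : 0 < 1 + e' by rewrite ltr_wpDr // ltW.
  have := lt_le_trans (le_lt_trans xyT (_ : _ < (1 + e') * (2 * (1 - d)))).
  rewrite (ltr_pM2l e'1_gt0) => /(_ _ lt_d) le_xy.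
  have := le_xy _ (lexx _); rewrite ltNge => /negP; apply; apply: le_trans xy.
  have : 0 <= e' * d by rewrite mulr_ge0 ?ltW.
  move: e'd; clear; lra.
have two : 1 + e' <= 2 by move: e'1; clear; lra.
rewrite -(TK _ HB) TB; apply: le_trans (U1 _) _.
apply: le_trans (ler_wpM2r (rnorm_ge0 _) two) _.
by rewrite mulrC -ler_pdivlMr.
Qed.

End uniform_convexity.

(** * Averaging operators on finite-dimensional l_p spaces *)

Lemma real_net (R : realType) (e : R) : 0 < e -> exists (I : finType) (c : I -> R),
  forall x, `|x| <= 1 -> exists i, `|x - c i| <= e.
Proof.
move=> e0; pose N := (Num.truncn e^-1).+1.
have N0 : 0 < N%:R :> R by rewrite ltr0n.
have Ne : N%:R^-1 <= e.
  rewrite -[e]invrK lef_pV2 ?posrE ?invr_gt0 //.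
  have := truncn_itv (ltW (_ : 0 < e^-1)).
  by rewrite invr_gt0 => /(_ e0) /andP[_ /ltW].
exists 'I_(2 * N).+1, (fun i : 'I_(2 * N).+1 => (i : nat)%:R / N%:R - 1) => x.
rewrite ler_norml => /andP[x1 x2].
have y0 : 0 <= (x + 1) * N%:R by rewrite mulr_ge0 ?(ltW N0) //; lra.
have := truncn_itv y0; set i := Num.truncn _ => /andP[i1 i2].
have iN : (i < (2 * N).+1)%N.
  rewrite ltnS -(ler_nat R); apply: le_trans i1 _.
  by rewrite natrM ler_pM2r //; lra.
exists (Ordinal iN); apply: le_trans Ne => /=.
have l1 : i%:R / N%:R <= x + 1 by rewrite ler_pdivrMr.
have l2 : x + 1 <= i%:R / N%:R + N%:R^-1.
  have -> : i%:R / N%:R + N%:R^-1 = i.+1%:R / N%:R :> R.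
    by rewrite -natr1 mulrDl mul1r.
  by rewrite ler_pdivlMr // ltW.
by rewrite ler_norml; apply/andP; split; lra.
Qed.

Lemma rnorm_complex_bounds (R : realType) (z : scalarField R ComplexScalars) :
  [/\ `|complex.Re (z : R[i])| <= rnorm z, `|complex.Im (z : R[i])| <= rnorm z &
      rnorm z <= `|complex.Re (z : R[i])| + `|complex.Im (z : R[i])|].
Proof.
rewrite rnorm_complex; case: z => a b /=.
split.
- by rewrite -sqrtr_sqr ler_wsqrtr // lerDl sqr_ge0.
- by rewrite -sqrtr_sqr ler_wsqrtr // lerDr sqr_ge0.
- rewrite -[leRHS]ger0_norm ?addr_ge0 // -sqrtr_sqr ler_wsqrtr //.
  rewrite sqrrD !real_normK ?num_real // lerD2r lerDl.
  by rewrite mulrn_wge0 // mulr_ge0.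
Qed.

Lemma scalar_net (R : realType) (s : scalars) (e : R) : 0 < e ->
  exists (I : finType) (c : I -> scalarField R s),
    forall z, rnorm z <= 1 -> exists i, rnorm (z - c i) <= e.
Proof.
move=> e0; case: s => [|]; first exact: real_net.
have [I [c cP]] := real_net (divr_gt0 e0 (ltr0n R 2)).
exists (I * I)%type, (fun i => (c i.1 +i* c i.2)%C) => -[a b] z1.
have [a1 b1 _] := rnorm_complex_bounds ((a +i* b)%C : scalarField R ComplexScalars).
have [i ai] := cP a (le_trans a1 z1); have [j bj] := cP b (le_trans b1 z1).
exists (i, j); have [_ _] := rnorm_complex_bounds
  ((a +i* b)%C - (c i +i* c j)%C : scalarField R ComplexScalars).
by move=> /le_trans; apply => /=; lra.
Qed.

(** Coordinates are partitioned by [cl]; on the class k the operator [class_avg]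
    is the projection onto the line of the weight vector w restricted to k, along
    the kernel of the functional that norms it.  The scalar m k u below is the
    w^p-mean of |u_j| / w_j over the class. *)
Section class_averaging.
Context {R : realType} {s : scalars} {p : R} {p1 : 1 < p}.
Local Notation K := (scalarField R s).
Variables (I : finType) (N : nat) (w : 'I_N -> R) (cl : 'I_N -> I).
Hypothesis w0 : forall j, 0 <= w j.
Local Notation lpN := (lp s (ltW p1) N).
Implicit Types (u : lpN) (k : I).

Definition class_mass k := \sum_(j | cl j == k) w j `^ p.

(** The factor is class_mass k to the power -1/q, with q conjugate to p, written
    so that it vanishes when the class has mass 0. *)
Definition class_coef k u : K :=
  ofReal s (class_mass k `^ p^-1 / class_mass k) *
  \sum_(j | cl j == k) ofReal s (w j `^ (p - 1)) * u 0 j.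

Definition class_vec k : lpN :=
  \row_j if cl j == k then ofReal s (w j / class_mass k `^ p^-1) else 0.

Definition class_avg u : lpN := \sum_k class_coef k u *: class_vec k.

Let p0 : 0 < p. Proof. exact: lt_trans p1. Qed.
Let S0 k : 0 <= class_mass k.
Proof. by apply: sumr_ge0 => j _; exact: powR_ge0. Qed.
Let m k u := (\sum_(j | cl j == k) w j `^ (p - 1) * rnorm (u 0 j)) / class_mass k.
Let m0 k u : 0 <= m k u.
Proof.
rewrite divr_ge0 // sumr_ge0 // => j _.
by rewrite mulr_ge0 ?powR_ge0 ?scalar_rnorm_ge0.
Qed.

Lemma class_mass_eq0 j : class_mass (cl j) = 0 -> w j = 0.
Proof.
move=> /eqP; rewrite psumr_eq0 => [|i _]; last exact: powR_ge0.
move=> /allP/(_ j (mem_index_enum j)); rewrite eqxx /= powR_eq0.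
by rewrite (gt_eqF p0) andbT => /eqP.
Qed.

Lemma class_coef_linear k (a : K) u v :
  class_coef k (a *: u + v) = a * class_coef k u + class_coef k v.
Proof.
rewrite /class_coef [a * _]mulrCA -mulrDr; congr (_ * _).
rewrite mulr_sumr -big_split; apply: eq_bigr => j _ /=.
by rewrite !mxE mulrDr mulrCA.
Qed.

Lemma class_avgE u j : class_avg u 0 j =
  class_coef (cl j) u * ofReal s (w j / class_mass (cl j) `^ p^-1).
Proof.
rewrite /class_avg summxE (bigD1 (cl j)) //= !mxE eqxx big1 ?addr0 // => k.
by rewrite eq_sym !mxE => /negbTE ->; rewrite mulr0.
Qed.

(** Jensen's inequality for the power p, obtained by summing the tangent lines at
    m k u. *)
Let jensen k u : m k u `^ p * class_mass k <= \sum_(j | cl j == k) rnorm (u 0 j) `^ p.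
Proof.
have [S_eq0|S_neq0] := eqVneq (class_mass k) 0.
  by rewrite S_eq0 mulr0 sumr_ge0 // => j _; exact: powR_ge0.
have mS : m k u * class_mass k = \sum_(j | cl j == k) w j `^ (p - 1) * rnorm (u 0 j).
  by rewrite divfK.
have tangent j : m k u `^ p * w j `^ p + p * m k u `^ (p - 1) *
    (w j `^ (p - 1) * rnorm (u 0 j) - m k u * w j `^ p) <= rnorm (u 0 j) `^ p.
  apply: le_trans (powR_tangent p1 (scalar_rnorm_ge0 _) (mulr_ge0 (m0 k u) (w0 j))).
  move: (m k u) (m0 k u) => mu mu0.
  rewrite !(powRM _ mu0 (w0 j)) lerD2l -!mulrA (ler_pM2l p0) ler_wpM2l ?powR_ge0 //.
  have wp : w j * w j `^ (p - 1) = w j `^ p by rewrite mulr_powRB1.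
  by rewrite mulrBr lerD2l lerN2 -wp mulrCA [w j * _]mulrC.
apply: le_trans (ler_sum _ (fun j _ => tangent j)).
rewrite big_split /= -!mulr_sumr sumrB -mulr_sumr -mS.
by rewrite subrr mulr0 addr0.
Qed.

Let coef_le k u : rnorm (class_coef k u) <= class_mass k `^ p^-1 * m k u.
Proof.
rewrite scalar_rnormM rnorm_ofReal ger0_norm ?divr_ge0 ?powR_ge0 //.
rewrite /m [leRHS]mulrCA [leRHS]mulrC ler_wpM2l ?divr_ge0 ?powR_ge0 //.
apply: le_trans (ler_scalar_rnorm_sum _ _ _) (ler_sum _ _) => j _.
by rewrite scalar_rnormM rnorm_ofReal ger0_norm ?powR_ge0.
Qed.

Let powR_le_inv (x y : R) : 0 <= x -> 0 <= y -> x `^ p <= y `^ p -> x <= y.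
Proof.
move=> x0 y0 le_p; rewrite leNgt; apply/negP => lt_e; move: le_p; apply/negP.
by rewrite -ltNge gt0_ltr_powR ?nnegrE.
Qed.

Let sum_class u : \sum_k \sum_(j | cl j == k) rnorm (u 0 j) `^ p = rnorm u `^ p.
Proof. by rewrite lp_powR (partition_big cl predT). Qed.

Lemma rnorm_class_coef k u : rnorm (class_coef k u) <= rnorm u.
Proof.
apply: le_trans (coef_le k u) _.
apply: powR_le_inv; [exact: mulr_ge0 (powR_ge0 _ _) (m0 k u)|exact: rnorm_ge0|].
rewrite (powRM _ (powR_ge0 _ _) (m0 k u)) -powRrM mulVf ?gt_eqF // powRr1 // mulrC.
apply: le_trans (jensen k u) _; rewrite -sum_class (bigD1 k) //= lerDl.
by apply: sumr_ge0 => i _; apply: sumr_ge0 => j _; exact: powR_ge0.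
Qed.

Lemma rnorm_class_vec k : rnorm (class_vec k) <= 1.
Proof.
apply: powR_le_inv; rewrite ?rnorm_ge0 // powR1 lp_powR.
have -> : \sum_j rnorm (class_vec k 0 j) `^ p =
    \sum_(j | cl j == k) (w j `^ p / class_mass k).
  rewrite [RHS]big_mkcond; apply: eq_bigr => j _; rewrite mxE.
  case: eqP => [_|_]; last by rewrite scalar_rnorm0 powR0 ?gt_eqF.
  rewrite rnorm_ofReal ger0_norm ?divr_ge0 ?powR_ge0 // powRM ?invr_ge0 ?powR_ge0 //.
  congr (_ * _); rewrite -(powR_inv1 (powR_ge0 _ _)) -powRrM [-1 * p]mulrC powRrM.
  by rewrite -[(class_mass k `^ _) `^ p]powRrM mulVf ?gt_eqF // powRr1 // powR_inv1.
rewrite -mulr_suml -/(class_mass k).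
have [->|S_neq0] := eqVneq (class_mass k) 0; first by rewrite mul0r ler01.
by rewrite divff.
Qed.

Lemma rnorm_class_avg u : rnorm (class_avg u) <= rnorm u.
Proof.
apply: powR_le_inv; [exact: rnorm_ge0|exact: rnorm_ge0|].
suff : \sum_k \sum_(j | cl j == k) rnorm (class_avg u 0 j) `^ p <=
    \sum_k \sum_(j | cl j == k) rnorm (u 0 j) `^ p by rewrite !sum_class.
apply: ler_sum => k _; apply: le_trans (jensen k u).
rewrite mulr_sumr; apply: ler_sum => j /eqP jk.
rewrite -(powRM _ (m0 k u) (w0 j)).
apply: ge0_ler_powR; rewrite ?nnegrE ?(ltW p0) ?scalar_rnorm_ge0 //.
  exact: mulr_ge0 (m0 k u) (w0 j).
rewrite class_avgE jk scalar_rnormM rnorm_ofReal ger0_norm ?divr_ge0 ?powR_ge0 //.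
apply: le_trans (ler_wpM2r _ (coef_le k u)) _; first by rewrite divr_ge0 ?powR_ge0.
move: (m k u) (m0 k u) (class_mass k `^ p^-1) => mu mu0 q.
have [->|q_neq0] := eqVneq q 0; first by rewrite invr0 !mulr0 mulr_ge0.
by rewrite [q * mu]mulrC mulrA mulrAC mulfK.
Qed.

(** The operator fixes the vectors that are proportional to the weight on each
    class. *)
Lemma class_avg_id (c : I -> K) :
  class_avg (\row_j (c (cl j) * ofReal s (w j))) = \row_j (c (cl j) * ofReal s (w j)).
Proof.
apply/rowP => j; rewrite class_avgE mxE.
have [S_eq0|S_neq0] := eqVneq (class_mass (cl j)) 0.
  by rewrite (class_mass_eq0 S_eq0) mul0r ofReal0 !mulr0.
have -> : class_coef (cl j) (\row_j (c (cl j) * ofReal s (w j))) =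
    c (cl j) * ofReal s (class_mass (cl j) `^ p^-1).
  rewrite /class_coef (eq_bigr (fun i => c (cl j) * ofReal s (w i `^ p))); last first.
    move=> i /eqP ij; rewrite mxE ij mulrCA -ofRealM; congr (_ * ofReal s _).
    by rewrite mulrC mulr_powRB1.
  rewrite -mulr_sumr -(big_morph _ (@ofRealD R s) (@ofReal0 R s)).
  by rewrite mulrCA -ofRealM divfK.
rewrite -mulrA -ofRealM; congr (_ * ofReal s _).
by rewrite mulrC divfK // powR_eq0 negb_and S_neq0.
Qed.

End class_averaging.

Lemma class_avgB (R : realType) (s : scalars) (p : R) (p1 : 1 < p) (I : finType)
  N (w : 'I_N -> R) (cl : 'I_N -> I) (u v : lp s (ltW p1) N) :
  class_avg w cl (u - v) = class_avg w cl u - class_avg w cl v.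
Proof.
rewrite /class_avg -sumrB; apply: eq_bigr => k _.
have := class_coef_linear w cl k (-1) v u; rewrite scaleN1r addrC => ->.
by rewrite mulN1r scalerDl scaleNr addrC.
Qed.

(** The weight is w = |h_1| + ... + |h_M|, and two coordinates are in the same class
    when for every i their ratios h_i / w have the same nearest point in a finite
    net of the unit disc.  Then h_i is close to a vector that is proportional to
    w on each class.  The number of classes depends on M and e only. *)
Lemma lp_local_approximation (R : realType) (s : scalars) (p : R) (p1 : 1 < p)
    (M : nat) (e : R) : 0 < e ->
  exists I : finType, forall N (h : 'I_M -> lp s (ltW p1) N),
  exists (phi : I -> lp s (ltW p1) N -> scalarField R s) (g : I -> lp s (ltW p1) N),
  [/\ forall k (a : scalarField R s) u v, phi k (a *: u + v) = a * phi k u + phi k v,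
      forall k u, rnorm (phi k u) <= rnorm u,
      forall k, rnorm (g k) <= 1,
      forall u, rnorm (\sum_k phi k u *: g k) <= rnorm u &
      forall i, rnorm (\sum_k phi k (h i) *: g k - h i) <= e * \sum_j rnorm (h j)].
Proof.
move=> e0; have p0 : 0 < p by exact: lt_trans p1.
have [J [c cP]] := @scalar_net R s _ (divr_gt0 e0 (ltr0n R 2)).
exists {ffun 'I_M -> J} => N h.
pose w (j : 'I_N) := \sum_i rnorm (h i 0 j).
have w0 j : 0 <= w j by apply: sumr_ge0 => i _; exact: scalar_rnorm_ge0.
have hw i j : rnorm (h i 0 j) <= w j.
  rewrite /w (bigD1 i) //= lerDl sumr_ge0 // => i' _; exact: scalar_rnorm_ge0.
have /choice[f fP] : forall ij : 'I_M * 'I_N, exists l : J,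
    rnorm (h ij.1 0 ij.2 - c l * ofReal s (w ij.2)) <= e / 2 * w ij.2.
  case=> i j /=; have [wj0|wj_neq0] := eqVneq (w j) 0.
    have hij0 : rnorm (h i 0 j) = 0.
      by apply/le_anti; rewrite scalar_rnorm_ge0 andbT -wj0.
    have [|l _] := cP 0; first by rewrite scalar_rnorm0.
    by exists l; rewrite wj0 ofReal0 !mulr0 subr0 hij0.
  have wj : 0 < w j by rewrite lt0r wj_neq0 w0.
  have [|l zl] := cP (h i 0 j * ofReal s (w j)^-1).
    by rewrite scalar_rnormM rnorm_ofReal ger0_norm ?invr_ge0 // ler_pdivrMr ?mul1r.
  exists l; rewrite -ler_pdivrMr //.
  have -> : (w j)^-1 = rnorm (ofReal s (w j)^-1).
    by rewrite rnorm_ofReal ger0_norm ?invr_ge0.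
  rewrite -scalar_rnormM mulrBl -mulrA -ofRealM divff //.
  by rewrite ofReal1 mulr1.
pose cl (j : 'I_N) : {ffun 'I_M -> J} := [ffun i => f (i, j)].
exists (class_coef w cl), (class_vec w cl).
split; [exact: class_coef_linear|exact: rnorm_class_coef|
  exact: rnorm_class_vec|exact: rnorm_class_avg|].
move=> i; rewrite -/(class_avg w cl (h i)).
pose u : lp s (ltW p1) N := \row_j (c (cl j i) * ofReal s (w j)).
pose W : lp s (ltW p1) N := \row_j ofReal s (w j).
have W_le : rnorm W <= \sum_j rnorm (h j).
  pose ha i : lp s (ltW p1) N := \row_j ofReal s (rnorm (h i 0 j)).
  have haE i' : rnorm (ha i') = rnorm (h i').
    rewrite !rnorm_lp /lp_norm; congr powR; apply: eq_bigr => j _.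
    by rewrite mxE rnorm_ofReal ger0_norm ?scalar_rnorm_ge0.
  have -> : W = \sum_i ha i.
    apply/rowP => j; rewrite summxE mxE (big_morph _ (@ofRealD R s) (@ofReal0 R s)).
    by apply: eq_bigr => i' _; rewrite mxE.
  rewrite (eq_bigr _ (fun i' _ => esym (haE i'))).
  elim/big_rec2: _ => [|i' x y _ le_xy]; first by rewrite rnorm0.
  by apply: le_trans (rnormD _ _) _; rewrite lerD2l.
have d_le : rnorm (h i - u) <= e / 2 * rnorm W.
  have -> : e / 2 * rnorm W = rnorm (ofReal s (e / 2) *: W).
    by rewrite rnormZ rnorm_ofReal ger0_norm // divr_ge0 // ltW.
  rewrite !rnorm_lp /lp_norm ge0_ler_powR ?nnegrE ?invr_ge0 ?(ltW p0) //.
  - by apply: sumr_ge0 => j _; exact: powR_ge0.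
  - by apply: sumr_ge0 => j _; exact: powR_ge0.
  apply: ler_sum => j _; rewrite ge0_ler_powR ?nnegrE ?scalar_rnorm_ge0 ?(ltW p0) //.
  rewrite !mxE scalar_rnormM !rnorm_ofReal !ger0_norm ?divr_ge0 ?(ltW e0) //.
  by have := fP (i, j); rewrite /= ffunE.
have uE : class_avg w cl u = u.
  exact: (class_avg_id (p1 := p1) cl w0 (fun k => c (k i))).
have -> : class_avg w cl (h i) - h i = class_avg w cl (h i - u) - (h i - u).
  by rewrite class_avgB uE opprB addrA subrK.
apply: le_trans (rnormD _ _) _.
rewrite rnormN; apply: le_trans (lerD (rnorm_class_avg cl w0 (h i - u)) (lexx _)) _.
by apply: le_trans (lerD d_le d_le) _; rewrite -mulrDl -splitr ler_pM2l.
Qed.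

(** * Almost common points of directed families of midpoint-closed sets *)

Section weak_cluster.
Context {R : realType} {s : scalars} {F : completeNormedModType (scalarField R s)}.
Local Notation K := (scalarField R s).

(** Let D be the supremum of the distances from 0 to the sets of the family.
    Points of norm almost D form small subsets of sufficiently late sets A,
    because the midpoint of two of them is again in A and so has norm almost D.
    They therefore generate a Cauchy filter, whose limit is the desired point. *)
Lemma directed_sets_almost_common_point (S : set (set F)) (B : R) :
  uniformly_convex F ->
  S !=set0 ->
  (forall A A', S A -> S A' -> exists2 A'', S A'' & A'' `<=` A `&` A') ->
  (forall A u v, S A -> A u -> A v -> A ((2^-1 : K) *: (u + v))) ->
  (forall A, S A -> exists2 v, A v & rnorm v <= B) ->
  exists x : F, forall A d, S A -> 0 < d -> exists2 v, A v & rnorm (v - x) < d.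
Proof.
move=> F_uc [A0 SA0] S_dir S_mid S_bnd.
pose dist A := inf [set rnorm v | v in A : set F].
have dist_has_inf A : S A -> has_inf [set rnorm v | v in A].
  move=> /S_bnd[v Av _]; split; first by exists (rnorm v), v.
  by exists 0 => _ [u _ <-]; exact: rnorm_ge0.
have dists_has_sup : has_sup [set dist A | A in S].
  split; first by exists (dist A0), A0.
  exists B => _ [A SA <-]; have [v Av vB] := S_bnd _ SA; apply: le_trans vB.
  by apply: ge_inf; [case: (dist_has_inf _ SA)|exists v].
pose D := sup [set dist A | A in S].
have near_D A d : S A -> 0 < d -> exists2 v, A v & rnorm v < D + d.
  move=> SA d0; have [_ [v Av <-] vd] := inf_adherent d0 (dist_has_inf _ SA).
  exists v => //; apply: lt_le_trans vd _; rewrite lerD2r.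
  by apply: ub_le_sup; [case: dists_has_sup|exists A].
have above_D d : 0 < d -> exists2 A, S A & forall v, A v -> D - d < rnorm v.
  move=> d0; have [_ [A SA <-] Dd] := sup_adherent d0 dists_has_sup.
  exists A => // v Av; apply: lt_le_trans Dd _.
  by apply: ge_inf; [case: (dist_has_inf _ SA)|exists v].
have D0 : 0 <= D.
  apply: le_trans (_ : dist A0 <= _); last first.
    by apply: ub_le_sup; [case: dists_has_sup|exists A0].
  apply: lb_le_inf; first by case: (dist_has_inf _ SA0).
  by move=> _ [u _ <-]; exact: rnorm_ge0.
have small e : 0 < e -> exists2 A, S A & exists2 d, 0 < d &
    forall u v, A u -> A v -> rnorm u < D + d -> rnorm v < D + d ->
    rnorm (u - v) < e.
  move=> e0; move: D0; rewrite le_eqVlt => /predU1P[D0|D0].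
    exists A0 => //; exists (e / 2); first exact: divr_gt0.
    rewrite -D0 add0r => u v _ _ ue ve; apply: le_lt_trans (rnormD _ _) _.
    by rewrite rnormN [e]splitr ltrD.
  have [t t0 F_t] := F_uc (e / (4 * D)) (divr_gt0 e0 (mulr_gt0 (ltr0n R 4) D0)).
  (* The bound d <= D t / 2 gives (1 - t) (D + d) <= D - d, so midpoints of norm
     more than D - d meet the threshold of uniform convexity after division by
     D + d <= 2 D. *)
  pose d := Num.min D (D * t / 2).
  have d0 : 0 < d by rewrite lt_min D0 /= divr_gt0 // mulr_gt0.
  have dD : d <= D by rewrite ge_min lexx.
  have dt : d <= D * t / 2 by rewrite ge_min lexx orbT.
  have [A SA AD] := above_D d d0; exists A => //; exists d => // u v Au Av ud vd.
  have Dd : 0 < D + d by exact: addr_gt0.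
  have mid := AD _ (S_mid _ _ _ SA Au Av); rewrite rnorm_half ltr_pdivlMr // in mid.
  pose c := ofReal s (D + d)^-1.
  have Ddv : 0 <= (D + d)^-1 by rewrite invr_ge0 ltW.
  have c1 (w : F) : rnorm w < D + d -> rnorm (c *: w) <= 1.
    by move=> w1; rewrite rnormZr // mulrC ler_pdivrMr // mul1r ltW.
  have := F_t _ _ (c1 _ ud) (c1 _ vd).
  rewrite -scalerDr -scalerBr !rnormZr // ![(D + d)^-1 * _]mulrC.
  rewrite ler_pdivlMr // ler_pdivrMr // => uv.
  have {}/uv uv : 2 * (1 - t) * (D + d) <= rnorm (u + v).
    apply: le_trans (ltW mid); have : 0 <= t * d by rewrite mulr_ge0 ?ltW.
    by move: dt; clear; lra.
  apply: le_lt_trans uv _.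
  have -> : e / (4 * D) * (D + d) = e * ((D + d) / (4 * D)) by ring.
  rewrite -[ltRHS]mulr1 ltr_pM2l // ltr_pdivrMr ?mulr_gt0 //.
  by move: dD D0; clear; lra.
pose Fl : set_system F := [set P | exists2 A, S A & exists2 d, 0 < d &
  forall v, A v -> rnorm v < D + d -> P v].
have Fl_proper : ProperFilter Fl.
  split.
    by case=> A SA [d d0 AP]; have [v /AP vP /vP] := near_D _ _ SA d0.
  split.
  - by exists A0 => //; exists 1.
  - move=> P Q [A SA [d d0 AP]] [A' SA' [d' d'0 AQ]].
    have [A'' SA'' AA] := S_dir _ _ SA SA'; exists A'' => //.
    exists (Num.min d d') => [|v /AA[Av A'v] vd]; first by rewrite lt_min d0.
    split; [apply: AP => //|apply: AQ => //]; apply: lt_le_trans vd _;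
    by rewrite lerD2l ge_min lexx ?orbT.
  - move=> P Q PQ [A SA [d d0 AP]]; exists A => //; exists d => // v Av vd.
    by apply: PQ; exact: AP.
have Fl_cauchy : cauchy Fl.
  apply: cauchy_exP => _ /gt0_ofReal[e e0 ->].
  have [A SA [d d0 AD]] := small e e0; have [v0 Av0 v0d] := near_D _ _ SA d0.
  by exists v0, A => //; exists d => // v Av vd; rewrite ball_rnorm; exact: AD.
have Fl_x : Fl --> lim Fl := cauchy_cvg Fl Fl_cauchy.
exists (lim Fl) => A d SA d0.
have [A' SA' [d' d'0 A'd]] : Fl (ball (lim Fl) (ofReal s d)).
  by apply: Fl_x; apply: nbhsx_ballx; rewrite -ofReal0 ltr_ofReal.
have [A'' SA'' AA] := S_dir _ _ SA SA'.
have [v /AA[Av A'v] vd] := near_D _ _ SA'' d'0.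
by exists v => //; have := A'd _ A'v vd; rewrite ball_rnorm rnormB.
Qed.

Definition midpoint_closed (I : Type) (C : set (I -> F)) := forall u v, C u -> C v ->
  C (fun k => (2^-1 : K) *: (u k + v k)).

(** A bounded filter base of midpoint-closed sets of families of vectors. *)
Record midpoint_base (I : Type) (Cs : set (set (I -> F))) : Prop := {
  base_bounded : exists2 C, Cs C &
    exists B : R, forall u, C u -> forall k, rnorm (u k) <= B;
  base_neq0 : forall C, Cs C -> C !=set0;
  base_directed : forall C C', Cs C -> Cs C' ->
    exists2 C'', Cs C'' & C'' `<=` C `&` C';
  base_midpoint : forall C, Cs C -> midpoint_closed C }.

(** The coordinates are treated one at a time: once the limit y of the coordinate k
    is known, every set of the base is cut down to the families whose k-th member
    is near y, which is again a base.  So the approximating families are the same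
    for all coordinates. *)
Lemma midpoint_base_almost_common_point (I : eqType) (r : seq I)
    (Cs : set (set (I -> F))) :
  uniformly_convex F -> midpoint_base Cs ->
  exists x : I -> F, forall C d, Cs C -> 0 < d ->
    exists2 u, C u & forall k, k \in r -> rnorm (u k - x k) < d.
Proof.
move=> F_uc; elim: r Cs => [|k r IH] Cs Cs_base.
  by exists (fun=> 0) => C d /(base_neq0 Cs_base)[u Cu] _; exists u.
have [C0 CsC0 [B C0B]] := base_bounded Cs_base.
pose S : set (set F) := [set [set u k | u in C] | C in Cs].
have [||||y yP] := @directed_sets_almost_common_point S B F_uc.
- by exists [set u k | u in C0], C0.
- move=> _ _ [C CsC <-] [C' CsC' <-].
  have [C'' CsC'' CC] := base_directed Cs_base CsC CsC'.
  exists [set u k | u in C'']; first by exists C''.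
  by move=> _ [u /CC[Cu C'u] <-]; split; exists u.
- move=> _ _ _ [C CsC <-] [u Cu <-] [v Cv <-].
  by eexists; first exact: (base_midpoint Cs_base CsC Cu Cv).
- move=> _ [C CsC <-]; have [C' CsC' CC] := base_directed Cs_base CsC CsC0.
  have [u /CC[Cu C0u]] := base_neq0 Cs_base CsC'.
  by exists (u k); [exists u|exact: C0B].
pose Cs' : set (set (I -> F)) := [set C' | exists C d,
  [/\ Cs C, 0 < d & C' = C `&` [set u | rnorm (u k - y) < d]]].
have [|x xP] := IH Cs'.
  split.
  - exists (C0 `&` [set u | rnorm (u k - y) < 1]); first by exists C0, 1.
    by exists B => u [/C0B].
  - move=> _ [C [d [CsC d0 ->]]]; have [|_ [u Cu <-] ud] := yP [set u k | u in C] d _ d0.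
      by exists C.
    by exists u.
  - move=> _ _ [C [d [CsC d0 ->]]] [C' [d' [CsC' d'0 ->]]].
    have [C'' CsC'' CC] := base_directed Cs_base CsC CsC'.
    exists (C'' `&` [set u | rnorm (u k - y) < Num.min d d']).
      by exists C'', (Num.min d d'); rewrite lt_min d0 d'0.
    move=> u [/CC[Cu C'u] /=]; rewrite lt_min => /andP[ud ud'].
    by split; split.
  - move=> _ [C [d [CsC d0 ->]]] u v [Cu /= ud] [Cv /= vd]; split.
      exact: (base_midpoint Cs_base CsC).
    rewrite /= midpointB rnorm_half ltr_pdivrMr //; apply: le_lt_trans (rnormD _ _) _.
    by rewrite mulr_natr mulr2n ltrD.
exists (fun i => if i == k then y else x i) => C d CsC d0.
have [|u [Cu ud] uP] := xP (C `&` [set u | rnorm (u k - y) < d]) d _ d0.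
  by exists C, d.
exists u => // i; rewrite inE; case: eqP => [-> _|_ /= ir]; first exact: ud.
exact: uP.
Qed.

End weak_cluster.

(** * Finite-rank contractions on the whole space *)

Lemma real_ultra_limit (R : realType) (T : Type) (U : set_system T)
    (a : T -> R) (B : R) : UltraFilter U -> U [set t | `|a t| <= B] ->
  exists l, forall e : R, 0 < e -> U [set t | `|a t - l| < e].
Proof.
move=> U_ultra UB.
have [l [_ l_cluster]] : exists l, (`[- B, B] `&` cluster (a @ U)) l.
  apply: segment_compact; rewrite /= /fmap /=.
  by apply: filterS UB => t /=; rewrite in_itv /= -ler_norml.
exists l => e e0.
have [//|far] := in_ultra_setVsetC [set t | `|a t - l| < e] U_ultra.
have [x [fe be]] := l_cluster [set x | ~ `|x - l| < e] _ far (nbhsx_ballx l e e0).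
by case: fe; move: be; rewrite -ball_normE /ball_ /= distrC.
Qed.

Lemma scalar_ultra_limit (R : realType) (s : scalars) (T : Type)
    (U : set_system T) (a : T -> scalarField R s) (B : R) :
  UltraFilter U -> U [set t | rnorm (a t) <= B] ->
  exists l, forall e : R, 0 < e -> U [set t | rnorm (a t - l) < e].
Proof.
move=> U_ultra; case: s a => [|] a UB; first exact: real_ultra_limit UB.
have [x xP] : exists x, forall e : R, 0 < e ->
    U [set t | `|complex.Re (a t : R[i]) - x| < e].
  apply: (@real_ultra_limit R T U _ B) => //; apply: filterS UB => t /=.
  by apply: le_trans; have [] := rnorm_complex_bounds (a t).
have [y yP] : exists y, forall e : R, 0 < e ->
    U [set t | `|complex.Im (a t : R[i]) - y| < e].
  apply: (@real_ultra_limit R T U _ B) => //; apply: filterS UB => t /=.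
  by apply: le_trans; have [] := rnorm_complex_bounds (a t).
exists (x +i* y)%C => e e0; have e2 : 0 < e / 2 by exact: divr_gt0.
apply: filterS (filterI (xP _ e2) (yP _ e2)) => t [/= xt yt].
have [_ _] := rnorm_complex_bounds (a t - (x +i* y)%C : scalarField R ComplexScalars).
move=> /le_lt_trans; apply; move: xt yt.
by case: (a t) => b c /= xt yt; rewrite [e]splitr ltrD.
Qed.

Section approximation.
Context {R : realType} {s : scalars} {p : R} {p1 : 1 < p}.
Local Notation K := (scalarField R s).

(** The index set I is chosen before the subspace H, so the rank of these operators
    is bounded uniformly in H; this is what survives in the limit over H. *)
Lemma Lp1plus_local_operators (F : normedModType K) (M : nat)
    (h : 'I_M -> F) (e : R) : Lp1plus (ltW p1) F -> 0 < e ->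
  exists I : finType, forall H : linSubspace F,
    finite_dim (linSubspace_type H) -> (forall i, (H : set F) (h i)) ->
  exists (phi : I -> F -> K) (g : I -> F),
  [/\ forall k (a : K) u v, (H : set F) u -> (H : set F) v ->
        phi k (a *: u + v) = a * phi k u + phi k v,
      forall k u, (H : set F) u -> rnorm (phi k u) <= rnorm u,
      forall k, rnorm (g k) <= 2,
      forall u, (H : set F) u ->
        rnorm (\sum_k phi k u *: g k) <= (1 + e) * rnorm u &
      forall i, rnorm (\sum_k phi k (h i) *: g k - h i) <= e].
Proof.
move=> Fp e0; set S := \sum_i rnorm (h i).
have S0 : 0 <= S by apply: sumr_ge0 => i _; exact: rnorm_ge0.
have e2 : 0 < e / 2 by exact: divr_gt0.
have S1 : 0 < S + 1 by rewrite ltr_wpDl.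
have [I IP] := @lp_local_approximation R s p p1 M _ (divr_gt0 e2 S1).
exists I => H H_fin Hh.
have e'0 : 0 < Num.min 1 e by rewrite lt_min ltr01.
have [n [T [U [T_lin TK T1 U1]]]] := Lp1plus_local Fp e'0 H_fin.
have e'1 : 1 + Num.min 1 e <= 2 by rewrite -[2]/(1 + 1) lerD2l ge_min lexx.
have e'e : 1 + Num.min 1 e <= 1 + e by rewrite lerD2l ge_min lexx orbT.
have [phi [g [phi_lin phi_le g1 Q_le Q_h]]] := IP n (T \o h).
have Q_U (u : F) : \sum_k phi k (T u) *: U (g k) = U (\sum_k phi k (T u) *: g k).
  by rewrite linear_sum; apply: eq_bigr => k _; rewrite linearZ.
exists (fun k u => phi k (T u)), (fun k => U (g k)).
split=> [k a u v Hu Hv|k u Hu|k|u Hu|i].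
- by rewrite T_lin // phi_lin.
- exact: le_trans (phi_le _ _) (T1 _ Hu).
- apply: le_trans (U1 _) _; rewrite -[leRHS]mulr1.
  by apply: ler_pM; rewrite ?rnorm_ge0 // addr_ge0 // ltW.
- rewrite Q_U; apply: le_trans (U1 _) _.
  apply: ler_pM; rewrite ?rnorm_ge0 //; first by rewrite addr_ge0 // ltW.
  exact: le_trans (Q_le _) (T1 _ Hu).
- rewrite Q_U -{2}(TK _ (Hh i)) -linearB.
  apply: le_trans (U1 _) _; apply: le_trans (ler_wpM2r (rnorm_ge0 _) e'1) _.
  apply: le_trans (ler_wpM2l (ler0n _ 2) (Q_h i)) _.
  have TS : \sum_j rnorm ((T \o h) j) <= S by apply: ler_sum => j _; exact: T1.
  rewrite mulrC -ler_pdivlMr //.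
  apply: le_trans (ler_wpM2l _ TS) _; first by rewrite divr_ge0 ?ltW.
  by rewrite mulrC mulr_div1D_le // ltW.
Qed.

(** In this section T indexes subspaces H t that eventually contain every vector,
    and each H t carries an operator given by I many functionals and vectors. *)
Section ultraproduct_limit.
Context {F : completeNormedModType K} {T : Type} {U : set_system T}.
Variables (I : finType) (H : T -> set F) (phi : T -> I -> F -> K) (g : T -> I -> F).
Hypotheses (F_uc : uniformly_convex F) (U_ultra : UltraFilter U).
Hypothesis H_eventually : forall u, U [set t | H t u].
Hypothesis phi_linear : forall t k (a : K) u v, H t u -> H t v ->
  phi t k (a *: u + v) = a * phi t k u + phi t k v.
Hypothesis phi_le : forall t k u, H t u -> rnorm (phi t k u) <= rnorm u.
Hypothesis g_le : forall t k, rnorm (g t k) <= 2.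

Lemma ultra_limit_functionals : exists f : I -> dual F,
  forall k u (e : R), 0 < e -> U [set t | rnorm (phi t k u - f k u) < e].
Proof.
have /choice[l lP] : forall ku : I * F, exists l : K,
    forall e : R, 0 < e -> U [set t | rnorm (phi t ku.1 ku.2 - l) < e].
  case=> k u /=; apply: (scalar_ultra_limit (B := rnorm u)) => //.
  by apply: filterS (H_eventually u) => t /= /phi_le.
have l_lin k : linear (fun u => l (k, u) : K^o).
  move=> a u v; apply/eqP; rewrite -subr_eq0; apply/eqP; apply: (@rnorm0_eq0 R s K^o).
  apply/le_anti; rewrite scalar_rnorm_ge0 andbT; apply/ler_addgt0Pr => e e0.
  rewrite add0r; have a2 : 0 < 2 + rnorm a by rewrite ltr_wpDr ?scalar_rnorm_ge0.
  have e'0 := divr_gt0 e0 a2; set e' := e / _ in e'0.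
  have [t [[[/= t1 t2] t3] [Hu Hv]]] := filter_ex (filterI (filterI (filterI
    (lP (k, a *: u + v) _ e'0) (lP (k, u) _ e'0)) (lP (k, v) _ e'0))
    (filterI (H_eventually u) (H_eventually v))).
  rewrite phi_linear // in t1.
  have -> : l (k, a *: u + v) - (a *: (l (k, u) : K^o) + l (k, v)) =
      a * (phi t k u - l (k, u)) + (phi t k v - l (k, v)) -
      (a * phi t k u + phi t k v - l (k, a *: u + v)).
    by rewrite /GRing.scale /=; ring.
  apply: le_trans (scalar_rnormD _ _) _.
  apply: le_trans (lerD (scalar_rnormD _ _) (lexx _)) _.
  rewrite scalar_rnormM [X in _ + X <= _](_ : _ =
    rnorm (a * phi t k u + phi t k v - l (k, a *: u + v))); last by rewrite /rnorm normrN.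
  have -> : e = rnorm a * e' + e' + e'.
    by rewrite /e'; field; rewrite gt_eqF.
  by rewrite !lerD ?(ltW t1) ?(ltW t3) // ler_wpM2l ?scalar_rnorm_ge0 // ltW.
have l_le k u : rnorm (l (k, u) : K^o) <= 1 * rnorm u.
  rewrite mul1r; apply/ler_addgt0Pr => e e0.
  have [t [/= t1 Hu]] := filter_ex (filterI (lP (k, u) _ e0) (H_eventually u)).
  have -> : l (k, u) = phi t k u - (phi t k u - l (k, u)) by ring.
  apply: le_trans (scalar_rnormD _ _) _; rewrite lerD ?phi_le //.
  by rewrite /rnorm normrN; exact: ltW.
exists (fun k => Bop (bounded_linear_mem (l_lin k) (@l_le k))) => k u e e0.
exact: (lP (k, u) e e0).
Qed.

(** A bound on || sum_k phi_t k u g_t k - z || describes, up to a small error, a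
    midpoint-closed set of families g_t once phi_t is replaced by its limit f.
    So it passes to a limit x of convex combinations of the families g_t. *)
Lemma ultra_limit_operator : exists (f : I -> dual F) (x : I -> F),
  forall u z (r : R), (U [set t | rnorm (\sum_k phi t k u *: g t k - z) <= r]) ->
    rnorm (\sum_k f k u *: x k - z) <= r.
Proof.
have [f fP] := ultra_limit_functionals; exists f.
(* These are the midpoint-closed sets that contain g_t for almost all t. *)
pose Cs : set (set (I -> F)) :=
  [set C | midpoint_closed C /\ U [set t | C (g t)]].
have mid_rnorm (V : normedModType K) (u v : V) (r : R) : rnorm u <= r -> rnorm v <= r ->
    rnorm ((2^-1 : K) *: (u + v)) <= r.
  move=> ur vr; rewrite rnorm_half ler_pdivrMr // mulr_natr mulr2n.
  exact: le_trans (rnormD _ _) (lerD ur vr).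
have Cs_base : midpoint_base Cs.
  split.
  - exists [set v | forall k, rnorm (v k) <= 2]; last by exists 2.
    split; first by move=> u v u2 v2 k; exact: mid_rnorm.
    by apply: filterS filterT => t _ k; exact: g_le.
  - by move=> C [_ /filter_ex[t Ct]]; exists (g t).
  - move=> C C' [C_mid UC] [C'_mid UC']; exists (C `&` C') => //; split.
      by move=> u v [Cu C'u] [Cv C'v]; split; [exact: C_mid|exact: C'_mid].
    by apply: filterS (filterI UC UC').
  - by move=> C [].
have [x xP] := midpoint_base_almost_common_point (enum I) F_uc Cs_base.
exists x => u z r Ur; apply/ler_addgt0Pr => e e0.
pose N := #|I|%:R * (rnorm u + 2) + 1 : R.
have N0 : 0 < N by rewrite ltr_wpDl // mulr_ge0 // addr_ge0 ?rnorm_ge0.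
pose d := e / 2 / N.
have d0 : 0 < d by rewrite !divr_gt0.
have dN c : 0 <= c -> c <= rnorm u + 2 -> \sum_(k : I) c * d <= e / 2.
  move=> c0 cu; 
  have -> : \sum_(k : I) c * d = #|I|%:R * c * (e / 2) / N.
    rewrite (_ : \sum_(k : I) c * d = (c * d) *+ #|I|); last exact: sumr_const.
    by rewrite /d; ring.
  rewrite ler_pdivrMr // mulrC ler_pM2l ?divr_gt0 //.
  apply: le_trans (_ : #|I|%:R * (rnorm u + 2) <= _).
    by rewrite ler_wpM2l.
  by rewrite lerDl.
pose C : set (I -> F) := [set v | rnorm (\sum_k f k u *: v k - z) <= r + e / 2].
have CsC : Cs C.
  split.
    move=> v w vr wr; rewrite /C /=.
    have -> : \sum_k f k u *: ((2^-1 : K) *: (v k + w k)) =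
        (2^-1 : K) *: (\sum_k f k u *: v k + \sum_k f k u *: w k).
      rewrite -big_split scaler_sumr; apply: eq_bigr => k _.
      by rewrite scalerA mulrC -scalerA scalerDr.
    by rewrite midpointB; exact: mid_rnorm.
  have U_f : U [set t | forall k, rnorm (phi t k u - f k u) < d].
    by apply: filter_forall => k; exact: fP.
  apply: filterS (filterI Ur U_f) => t [/= tr td]; rewrite /C /=.
  have -> : \sum_k f k u *: g t k - z = (\sum_k phi t k u *: g t k - z) -
      \sum_k (phi t k u - f k u) *: g t k.
    under [X in _ = _ - X]eq_bigr do rewrite scalerBl.
    by rewrite sumrB opprB [RHS]addrC subrKA.
  apply: le_trans (rnormD _ _) (lerD tr _).
  rewrite rnormN; apply: le_trans (ler_rnorm_sum _ _ _) _.
  apply: le_trans (dN 2 _ _) => //; last by rewrite lerDr rnorm_ge0.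
  apply: ler_sum => k _; rewrite rnormZ mulrC ler_pM ?rnorm_ge0 ?scalar_rnorm_ge0 //.
  exact: ltW.
have [v vr vd] := xP C d CsC d0.
have -> : \sum_k f k u *: x k - z = (\sum_k f k u *: v k - z) -
    \sum_k f k u *: (v k - x k).
  under [X in _ = _ - X]eq_bigr do rewrite scalerBr.
  by rewrite sumrB opprB [RHS]addrC subrKA.
apply: le_trans (rnormD _ _) _; rewrite [e]splitr addrA; apply: lerD; first exact: vr.
rewrite rnormN; apply: le_trans (ler_rnorm_sum _ _ _) _.
apply: le_trans (dN (rnorm u) _ _); rewrite ?rnorm_ge0 ?lerDl //.
apply: ler_sum => k _; rewrite rnormZ ler_pM ?rnorm_ge0 ?scalar_rnorm_ge0 //; last first.
  by apply/ltW/vd; rewrite mem_enum.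
apply/ler_addgt0Pr => e' e'0.
have [t [/= t1 Hu]] := filter_ex (filterI (fP k u _ e'0) (H_eventually u)).
have -> : f k u = phi t k u - (phi t k u - f k u) by rewrite opprB addrC subrK.
apply: le_trans (scalar_rnormD _ _) _; rewrite lerD ?phi_le //.
by rewrite /rnorm normrN; exact: ltW.
Qed.

End ultraproduct_limit.
End approximation.

(** * Finite sums of rank-one operators *)

Section tensors.
Context {R : realType} {s : scalars}.
Local Notation K := (scalarField R s).
Implicit Types E F G : normedModType K.

Lemma rank_one_linear E F (f : dual E) (y : F) : linear (fun u => (f u : K) *: y).
Proof.
move=> a u v; have -> : f (a *: u + v) = a *: f u + f v := bop_linear f a u v.
by rewrite scalerDl -scalerA.
Qed.

Lemma rank_one_bounded E F (f : dual E) (y : F) u :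
  rnorm ((f u : K) *: y) <= (rnorm f * rnorm y) * rnorm u.
Proof. by rewrite rnormZ mulrAC ler_wpM2r ?rnorm_ge0 // rnorm_bop opnormP. Qed.

Definition rank_one E F (f : dual E) (y : F) : bop E F :=
  Bop (bounded_linear_mem (rank_one_linear f y) (rank_one_bounded f y)).

Lemma comp_linear E F G (T : bop E F) (S : bop F G) : linear (S \o T).
Proof. by move=> a u v; rewrite /= (bop_linear T) (bop_linear S). Qed.

Lemma comp_bounded E F G (T : bop E F) (S : bop F G) u :
  rnorm ((S \o T) u) <= (opnorm S * opnorm T) * rnorm u.
Proof.
apply: le_trans (opnormP S _) _.
by rewrite -mulrA ler_wpM2l ?opnorm_ge0 ?opnormP.
Qed.

Definition bop_comp E F G (T : bop E F) (S : bop F G) : bop E G :=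
  Bop (bounded_linear_mem (@comp_linear _ _ _ T S) (@comp_bounded _ _ _ T S)).

Lemma bop_sumE E F (I : Type) (r : seq I) (T : I -> bop E F) u :
  (\sum_(i <- r) T i) u = \sum_(i <- r) T i u.
Proof.
elim: r => [|i r IH]; first by rewrite !big_nil.
by rewrite !big_cons -IH.
Qed.

Lemma rnorm_bop_le E F (T : bop E F) (M : R) :
  (forall u, rnorm u <= 1 -> rnorm (T u) <= M) -> rnorm T <= M.
Proof. by rewrite rnorm_bop; exact: opnorm_le. Qed.

Lemma bop_le_rnorm E F (T : bop E F) u : rnorm (T u) <= rnorm T * rnorm u.
Proof. by rewrite rnorm_bop; exact: opnormP. Qed.

(** Given by the values, rather than as an equation between operators, so that
    composition with an operator on E is immediate. *)
Definition tensor_sum E F (T : bop E F) := exists (I : finType) (f : I -> dual E)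
  (y : I -> F), forall u, T u = \sum_k (f k u : K) *: y k.

Lemma tensor_sumZ E F (a : K) (T : bop E F) : tensor_sum T -> tensor_sum (a *: T).
Proof.
move=> [I [f [y TE]]]; exists I, f, (fun k => a *: y k) => u.
rewrite -[LHS]/(a *: T u) TE scaler_sumr; apply: eq_bigr => k _.
by rewrite !scalerA mulrC.
Qed.

Lemma tensor_sumD E F (T S : bop E F) :
  tensor_sum T -> tensor_sum S -> tensor_sum (T + S).
Proof.
move=> [I [f [y TE]]] [J [g [z SE]]]; exists (I + J)%type,
  (fun k => match k with inl i => f i | inr j => g j end),
  (fun k => match k with inl i => y i | inr j => z j end) => u.
by rewrite big_sumType -TE -SE.
Qed.

Lemma tensor_sum_comp E F G (T : bop E F) (S : bop F G) :
  tensor_sum S -> tensor_sum (bop_comp T S).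
Proof.
by move=> [I [f [y SE]]]; exists I, (fun k => bop_comp T (f k)), y => u; exact: SE.
Qed.

Lemma finite_rank_sum E F (I : Type) (r : seq I) (f : I -> dual E) (y : I -> F) :
  finite_rank (\sum_(i <- r) rank_one (f i) (y i)).
Proof.
apply: (finite_dim_in_span (g := fun i => y (tnth (in_tuple r) i))) => _ [u _ <-].
exists (\row_i (f (tnth (in_tuple r) i) u : K)); rewrite bop_sumE big_tnth.
by apply: eq_bigr => i _; rewrite mxE.
Qed.

Lemma separable_dense_sequence (V : normedModType K) : separable_space V ->
  exists d : nat -> V, forall v (e : R), 0 < e -> exists n, rnorm (v - d n) < e.
Proof.
move=> [D D_count D_dense]; have near_D (v : V) (e : R) : 0 < e ->
    exists2 w, D w & rnorm (v - w) < e.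
  move=> e0; have [|w [vw Dw]] := D_dense _ _ (ball_open v (ofReal s e)).
    by exists v; apply: ballxx; rewrite -ofReal0 ltr_ofReal.
  by exists w => //; move: vw; rewrite ball_rnorm.
move: D_count => /pfcard_geP[D0|[g]].
  by have [w] := near_D 0 1 ltr01; rewrite D0.
exists g => v e e0; have [w Dw vw] := near_D v e e0.
have g_surj : set_surj setT D g by exact: surj.
by have [n _ gn] := g_surj _ Dw; exists n; rewrite gn.
Qed.

Section countable_approximation.
Variables (E F : normedModType K) (f : nat -> dual E) (y : nat -> F).
Hypothesis f_dense : forall g (e : R), 0 < e -> exists n, rnorm (g - f n) < e.
Hypothesis y_dense : forall z (e : R), 0 < e -> exists n, rnorm (z - y n) < e.

(** Codes form a countable type, so these operators can be enumerated. *)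
Definition coded_operator (c : seq (nat * nat)) : bop E F :=
  \sum_(ab <- c) rank_one (f ab.1) (y ab.2).

Lemma rank_one_approx g z (e : R) : 0 < e ->
  exists m n, rnorm (rank_one g z - rank_one (f m) (y n)) <= e.
Proof.
move=> e0; have e2 : 0 < e / 2 by exact: divr_gt0.
have z0 := rnorm_ge0 z; have z1 : 0 < rnorm z + 1 by rewrite ltr_wpDl.
have [m gm] := f_dense g (divr_gt0 e2 z1).
have fm0 := rnorm_ge0 (f m); have m1 : 0 < rnorm (f m) + 1 by rewrite ltr_wpDl.
have [n zn] := y_dense z (divr_gt0 e2 m1).
exists m, n; apply: rnorm_bop_le => u u1.
have -> : (rank_one g z - rank_one (f m) (y n)) u =
    ((g - f m) u : K) *: z + (f m u : K) *: (z - y n).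
  rewrite -[LHS]/((g u : K) *: z - (f m u : K) *: y n).
  by rewrite -[(g - f m) u]/(g u - f m u : K) scalerBl scalerBr addrA subrK.
have le_unit (w : dual E) : rnorm (w u) <= rnorm w.
  apply: le_trans (bop_le_rnorm _ _) _.
  by rewrite -[leRHS]mulr1 ler_wpM2l ?rnorm_ge0.
apply: le_trans (rnormD _ _) _; rewrite !rnormZ [e]splitr; apply: lerD.
  apply: le_trans (mulr_div1D_le z0 (ltW e2)); rewrite mulrC.
  by rewrite ler_wpM2l // (le_trans (le_unit _)) // ltW.
apply: le_trans (mulr_div1D_le fm0 (ltW e2)).
by rewrite ler_pM ?rnorm_ge0 ?le_unit // ltW.
Qed.

Lemma tensor_sum_approx (T : bop E F) (e : R) : tensor_sum T -> 0 < e ->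
  exists c, rnorm (T - coded_operator c) <= e.
Proof.
move=> [I [g [z TE]]] e0.
have -> : T = \sum_(k <- enum I) rank_one (g k) (z k).
  by apply/val_inj/funext => u; rewrite /= bop_sumE big_enum; exact: TE.
elim: (enum I) e e0 => [|k r IH] e e0.
  by exists [::]; rewrite /coded_operator !big_nil subr0 rnorm0 ltW.
have e2 := divr_gt0 e0 (ltr0n R 2).
have [c cP] := IH _ e2; have [m [n mnP]] := rank_one_approx (g k) (z k) e2.
exists ((m, n) :: c); rewrite /coded_operator !big_cons /= opprD addrACA.
by apply: le_trans (rnormD _ _) _; rewrite [e]splitr lerD.
Qed.

(** The centres are all coded operators of norm at least r1 - d, where d is a quarter
    of r1 - r0; approximating S within d moves both bounds by d only. *)
Lemma UBCP_of_tensor_approximation (Z : linSubspace (bop E F)) (r0 r1 : R) :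
  [set T : bop E F | finite_rank T] `<=` Z -> 0 < r0 -> r0 < r1 ->
  (forall T : bop E F, rnorm T = 1 -> exists S : bop E F,
    [/\ tensor_sum S, rnorm (T - S) <= r0 & r1 <= rnorm S]) ->
  UBCP (linSubspace_type Z).
Proof.
move=> Z_fr r0_gt0 r01 approx.
pose d := (r1 - r0) / 4; have d0 : 0 < d by rewrite divr_gt0 // subr_gt0.
have approx_c (T : bop E F) : rnorm T = 1 -> exists c,
    rnorm (T - coded_operator c) <= r0 + d /\ r1 - d <= rnorm (coded_operator c).
  move=> /approx[S [S_tensor TS r1S]]; have [c Sc] := tensor_sum_approx S_tensor d0.
  exists c; split.
    rewrite -[T - _](subrKA S); apply: le_trans (rnormD _ _) _; exact: lerD.
  rewrite lerBlDr; apply: le_trans r1S _.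
  rewrite -{1}[S](subrK (coded_operator c)) addrC.
  exact: le_trans (rnormD _ _) (lerD (lexx _) Sc).
have [Z0|] := pselect (forall x : linSubspace_type Z, x = 0); first by left.
move=> /existsNP[x /eqP x0]; right.
have rx0 : 0 < rnorm x.
  rewrite lt0r rnorm_ge0 andbT; by apply: contraNneq x0 => /rnorm0_eq0 ->.
have [c0 [_ c0P]] : exists c0,
    rnorm (ofReal s (rnorm x)^-1 *: val x - coded_operator c0) <= r0 + d /\
    r1 - d <= rnorm (coded_operator c0).
  apply: approx_c; rewrite rnormZr ?invr_ge0 ?rnorm_ge0 //.
  by rewrite -[rnorm (val x)]/(rnorm x) mulVf // gt_eqF.
pose zc c : linSubspace_type Z := LinSubspaceElt
  (asboolT (Z_fr (coded_operator c) (finite_rank_sum c (f \o fst) (y \o snd)))).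
(* Numbers that code no large operator are sent to the fixed centre zc c0. *)
pose z j := if unpickle j is Some c then
  (if r1 - d <= rnorm (zc c) then zc c else zc c0) else zc c0.
have z_ge j : r1 - d <= rnorm (z j).
  by rewrite /z; case: unpickle => [c|]; first case: ifP => // _; exact: c0P.
exists (r0 + d + d / 2), z; split.
- by apply: addr_gt0; [exact: addr_gt0|exact: divr_gt0].
- move=> T T1; have [c [Tc cP]] := approx_c (val T) T1.
  exists (pickle c) => //; rewrite ball_rnorm rnormB /z pickleK ifT //.
  by apply: le_lt_trans Tc _; rewrite ltrDl divr_gt0.
- apply: (@lt_le_trans _ _ (r1 - d)); first by rewrite /d in d0 *; lra.
  apply: lb_le_inf; first by exists (rnorm (z 0%N)), 0%N.
  by move=> _ [j _ <-].
Qed.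

End countable_approximation.
End tensors.

(** * Approximation of operators of norm one *)

Lemma finite_rank_almost_contraction (R : realType) (s : scalars)
    (p : R) (p1 : 1 < p) (F : completeNormedModType (scalarField R s))
    (l : seq F) (e : R) : Lp1plus (ltW p1) F -> 0 < e ->
  exists P : bop F F, [/\ tensor_sum P,
    forall u, rnorm (P u) <= (1 + e) * rnorm u &
    forall v, v \in l -> rnorm (P v - v) <= e].
Proof.
move=> Fp e0; have F_uc := Lp1plus_uniformly_convex Fp.
have [I IP] := Lp1plus_local_operators (fun i : 'I_(size l) => l`_i) Fp e0.
pose H (t : seq F) : linSubspace F := list_span (t ++ l).
have /choice[D DP] : forall t, exists D : (I -> F -> scalarField R s) * (I -> F),
  [/\ forall k (a : scalarField R s) u v, (H t : set F) u -> (H t : set F) v ->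
        D.1 k (a *: u + v) = a * D.1 k u + D.1 k v,
      forall k u, (H t : set F) u -> rnorm (D.1 k u) <= rnorm u,
      forall k, rnorm (D.2 k) <= 2,
      forall u, (H t : set F) u ->
        rnorm (\sum_k D.1 k u *: D.2 k) <= (1 + e) * rnorm u &
      forall i : 'I_(size l), rnorm (\sum_k D.1 k l`_i *: D.2 k - l`_i) <= e].
  move=> t; have [|phi [g phi_g]] := IP (H t) (finite_dim_list_span _).
    by move=> i; apply: mem_list_span; rewrite mem_cat mem_nth ?orbT.
  by exists (phi, g).
(* A set of lists is large when it contains every list extending some t0. *)
pose Fl : set_system (seq F) := [set A : set (seq F) | exists t0 : seq F,
  forall t : seq F, {subset t0 <= t} -> A t].
have Fl_proper : ProperFilter Fl.
  split; first by case=> t0 /(_ t0); exact.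
  split.
  - by exists [::].
  - move=> A B [t At] [t' Bt']; exists (t ++ t') => t'' sub; split.
      by apply: At => v vt; apply: sub; rewrite mem_cat vt.
    by apply: Bt' => v vt; apply: sub; rewrite mem_cat vt orbT.
  - by move=> A B AB [t At]; exists t => t' /At /AB.
have [U [U_ultra FlU]] := ultraFilterLemma Fl_proper.
have UH u : U [set t | (H t : set F) u].
  apply: FlU; exists [:: u] => t ut; apply: mem_list_span.
  by rewrite mem_cat ut // inE.
have [|||f [x fx]] := @ultra_limit_operator R s F (seq F) U I
    (fun t => H t : set F) (fun t => (D t).1) (fun t => (D t).2) F_uc U_ultra UH.
- by move=> t; have [] := DP t.
- by move=> t; have [] := DP t.
- by move=> t; have [] := DP t.
pose P := \sum_(k <- enum I) rank_one (f k) (x k).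
have PE u : P u = \sum_k (f k u : scalarField R s) *: x k by rewrite bop_sumE big_enum.
exists P; split; first by exists I, f, x.
- move=> u; rewrite PE -[X in rnorm X]subr0; apply: fx.
  apply: filterS (UH u) => t Hu /=; rewrite subr0.
  by have [_ _ _ + _] := DP t; exact.
- move=> v /(nthP 0)[i il <-]; rewrite PE; apply: fx.
  apply: filterS filterT => t _ /=.
  by have [_ _ _ _ +] := DP t; move=> /(_ (Ordinal il)).
Qed.

(** Divide an almost contraction by the bound for its norm. *)
Lemma finite_rank_contraction (R : realType) (s : scalars)
    (p : R) (p1 : 1 < p) (F : completeNormedModType (scalarField R s))
    (l : seq F) (e : R) : Lp1plus (ltW p1) F -> 0 < e ->
  exists P : bop F F, [/\ tensor_sum P,
    forall u, rnorm (P u) <= rnorm u &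
    forall v, v \in l -> rnorm (P v - v) <= e].
Proof.
move=> Fp e0; pose B := \sum_(v <- l) rnorm v.
have B0 : 0 <= B by apply: sumr_ge0 => v _; exact: rnorm_ge0.
have B1 : 0 < B + 1 by rewrite ltr_wpDl.
pose d := e / (B + 1); have d0 : 0 < d by rewrite divr_gt0.
have [P [P_tensor P_le Pl]] := finite_rank_almost_contraction l Fp d0.
have c0 : 0 < 1 + d by rewrite addr_gt0.
pose c := (1 + d)^-1; have cV : 0 < c by rewrite invr_gt0.
exists (ofReal s c *: P); split; first exact: tensor_sumZ.
  move=> u; rewrite -[X in rnorm X]/(ofReal s c *: P u) rnormZr ?(ltW cV) //.
  by rewrite mulrC ler_pdivrMr // mulrC.
move=> v vl; rewrite -[X in rnorm (X - _)]/(ofReal s c *: P v).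
have -> : ofReal s c *: P v - v = ofReal s c *: (P v - v) - ofReal s (1 - c) *: v.
  rewrite ofRealD ofReal1 scalerDl scale1r scalerBr opprD addrA.
  have -> : ofReal s (- c) = - ofReal s c by case: (s) => //=; rewrite rmorphN.
  by rewrite scaleNr opprK addrAC subrK.
have c1 : c * d = 1 - c by rewrite /c; field; rewrite gt_eqF.
have c1_ge0 : 0 <= 1 - c by rewrite -c1 mulr_ge0 // ltW.
have vB : rnorm v <= B.
  rewrite /B (perm_big _ (perm_to_rem vl)) big_cons lerDl.
  by apply: sumr_ge0 => w _; exact: rnorm_ge0.
apply: le_trans (rnormD _ _) _; rewrite rnormN !rnormZr ?(ltW cV) //.
rewrite -c1 -mulrA -mulrDr.
have dv0 : 0 <= d * rnorm v by rewrite mulr_ge0 ?rnorm_ge0 ?(ltW d0).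
apply: (@le_trans _ _ (1 * (d + d * B))); last first.
  by rewrite mul1r -{1}[d]mulr1 -mulrDr addrC /d divfK // gt_eqF.
apply: ler_pM; [exact: ltW|by rewrite addr_ge0 ?rnorm_ge0| |].
  by rewrite /c invf_le1 // lerDl ltW.
by rewrite lerD ?Pl // ler_pM2l.
Qed.

(** The average of two contractions, of which the second almost fixes the range of
    the first, stays at a distance less than 1 from a small multiple of the
    identity.  The range condition links u itself to P1 u, because P2 maps
    u + P1 u almost to P2 u + P1 u without increasing the norm. *)
Lemma finite_rank_near_scaled_identity (R : realType) (s : scalars)
    (p : R) (p1 : 1 < p) (F : completeNormedModType (scalarField R s)) :
  Lp1plus (ltW p1) F -> exists (t rho : R),
  [/\ 0 < t, 0 < rho, rho < 1 & forall (y : F) (e : R), 0 < e ->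
  exists A : bop F F, [/\ tensor_sum A,
    forall u, rnorm u <= 1 -> rnorm (A u - ofReal s t *: u) <= rho &
    rnorm (A y - y) <= e]].
Proof.
move=> Fp.
have [d' d'0 F_uc] := Lp1plus_uniformly_convex Fp (divr_gt0 ltr01 (ltr0n R 4)).
pose d := Num.min 1 d'; have d0 : 0 < d by rewrite lt_min ltr01.
have d1 : d <= 1 by rewrite ge_min lexx.
have dd' : d <= d' by rewrite ge_min lexx orbT.
(* When ||P1 u + P2 u|| < 2 - d the bound is (1 - d/2) + d/4; otherwise
   ||A u - u|| <= 1/2 and, with t = d/4, the bound is (1 - t) + t/2 = 1 - d/8. *)
exists (d / 4), (1 - d / 8); clearbody d; split; [lra|lra|lra|].
move=> y e e0.
have [P1 [P1_tensor P1_le P1y]] := finite_rank_contraction [:: y] Fp e0.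
have [I [f [x P1E]]] := P1_tensor.
pose B := \sum_k rnorm (f k).
have B0 : 0 <= B by apply: sumr_ge0 => v _; exact: rnorm_ge0.
have B1 : 0 < B + 1 by rewrite ltr_wpDl.
have e20 : 0 < Num.min e (d / (B + 1)) by rewrite lt_min e0 divr_gt0.
have [P2 [P2_tensor P2_le P2x]] := finite_rank_contraction (y :: codom x) Fp e20.
have P21 u : rnorm u <= 1 -> rnorm (P2 (P1 u) - P1 u) <= d.
  move=> u1; have -> : P2 (P1 u) - P1 u =
      \sum_k (f k u : scalarField R s) *: (P2 (x k) - x k).
    rewrite P1E linear_sum -sumrB; apply: eq_bigr => k _.
    by rewrite linearZ scalerBr.
  apply: le_trans (ler_rnorm_sum _ _ _) _.
  apply: (@le_trans _ _ (\sum_k rnorm (f k) * (d / (B + 1)))).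
    apply: ler_sum => k _; rewrite rnormZ.
    apply: ler_pM; rewrite ?rnorm_ge0 ?scalar_rnorm_ge0 //.
      by apply: le_trans (bop_le_rnorm _ _) _; rewrite ler_piMr ?rnorm_ge0.
    apply: (le_trans (P2x _ _)); first by rewrite inE codom_f orbT.
    by rewrite ge_min lexx orbT.
  by rewrite -mulr_suml mulr_div1D_le // ltW.
exists ((2^-1 : scalarField R s) *: (P1 + P2)).
split; first exact: tensor_sumZ (tensor_sumD _ _).
  move=> u u1.
  rewrite -[X in rnorm (X - _)]/((2^-1 : scalarField R s) *: (P1 u + P2 u)).
  have a1 := le_trans (P1_le u) u1; have b1 := le_trans (P2_le u) u1.
  have d4 : 0 <= d / 4 by rewrite divr_ge0 ?(ltW d0).
  have [ab|ab] := ltP (rnorm (P1 u + P2 u)) (2 - d).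
    apply: le_trans (rnormD _ _) _.
    rewrite rnormN rnorm_half rnormZr //.
    apply: (@le_trans _ _ ((2 - d) / 2 + d / 4 * 1)).
      by rewrite lerD ?ler_wpM2l // ler_pM2r ?invr_gt0 // ltW.
    by move: d0; clear; lra.
  have dd : 2 * (1 - d') <= 2 - d - d by move: dd'; clear; lra.
  have ba : rnorm (P2 u - P1 u) <= 1 / 4.
    rewrite rnormB; apply: F_uc => //; apply: le_trans dd (le_trans _ ab).
    by rewrite gerBl ltW.
  have ua : rnorm (P1 u - u) <= 1 / 4.
    rewrite rnormB; apply: F_uc => //; apply: le_trans dd _.
    apply: le_trans (P2_le _).
    have -> : P2 (u + P1 u) = P2 (P1 u) + P2 u by rewrite linearD addrC.
    rewrite lerBlDr; apply: le_trans ab _.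
    have -> : P1 u + P2 u = P2 (P1 u) + P2 u - (P2 (P1 u) - P1 u).
      by rewrite opprB [RHS]addrC subrKA.
    apply: le_trans (rnormD _ _) _; rewrite lerD2l.
    by rewrite rnormN; exact: P21.
  set M := (2^-1 : scalarField R s) *: (P1 u + P2 u).
  have M1 : rnorm M <= 1.
    rewrite rnorm_half ler_pdivrMr // mul1r -[2]/(1 + 1).
    exact: le_trans (rnormD _ _) (lerD a1 b1).
  have Mu : rnorm (M - u) <= 1 / 2.
    have -> : M - u = (P1 u - u) + (2^-1 : scalarField R s) *: (P2 u - P1 u).
      rewrite /M; have -> : P1 u + P2 u = (P1 u + P1 u) + (P2 u - P1 u).
        by rewrite addrACA subrr addr0 addrC.
      rewrite scalerDr -mulr2n -[P1 u *+ 2]scaler_nat scalerA mulVf ?pnatr_eq0 //.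
      by rewrite scale1r addrAC.
    apply: le_trans (rnormD _ _) _; rewrite rnorm_half.
    by move: (rnorm _) (rnorm (P2 u - P1 u)) ua ba; clear => r1 r2 ? ?; lra.
  have -> : M - ofReal s (d / 4) *: u =
      ofReal s (1 - d / 4) *: M + ofReal s (d / 4) *: (M - u).
    by rewrite scalerBr addrA -scalerDl -ofRealD subrK ofReal1 scale1r.
  apply: le_trans (rnormD _ _) _.
  rewrite !rnormZr //; last by move: d1; clear; lra.
  apply: (@le_trans _ _ ((1 - d / 4) * 1 + d / 4 * (1 / 2))).
    by rewrite lerD // ler_wpM2l //; move: d1; clear; lra.
  by clear; lra.
rewrite -[X in rnorm (X - _)]/((2^-1 : scalarField R s) *: (P1 y + P2 y)) midpointB.
rewrite rnorm_half ler_pdivrMr // mulr_natr mulr2n.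
apply: le_trans (rnormD _ _) (lerD _ _); first by apply: P1y; rewrite inE.
apply: (le_trans (P2x _ _)); first by rewrite inE eqxx.
by rewrite ge_min lexx.
Qed.

(** Since T - t^-1 A T = - t^-1 (A - t I) T, the distance from T is governed by A - t I
    and the norm of t^-1 A T by the value of A at a vector T x of norm almost 1. *)
Lemma tensor_approximation_unit_operators (R : realType) (s : scalars)
    (p : R) (p1 : 1 < p) (F : completeNormedModType (scalarField R s))
    (E : normedModType (scalarField R s)) :
  Lp1plus (ltW p1) F -> exists r0 r1 : R,
  [/\ 0 < r0, r0 < r1 & forall T : bop E F, rnorm T = 1 -> exists S : bop E F,
    [/\ tensor_sum S, rnorm (T - S) <= r0 & r1 <= rnorm S]].
Proof.
move=> Fp.
have [t [rho [t0 rho0 rho1 near_id]]] := finite_rank_near_scaled_identity Fp.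
pose d := (1 - rho) / 4; have d0 : 0 < d by rewrite divr_gt0 // subr_gt0.
exists (rho / t), ((1 - d - d) / t); split.
- by rewrite divr_gt0.
- by rewrite ltr_pM2r ?invr_gt0 // /d; move: rho1; clear; lra.
move=> T T1.
have [_ [x /= x1 <-] Tx] := sup_adherent d0 (opnorm_has_sup T).
rewrite -/(opnorm T) -rnorm_bop T1 in Tx.
have [A [A_tensor A_id Ay]] := near_id (T x) d d0.
have AT_tensor := tensor_sum_comp T A_tensor.
exists (ofReal s t^-1 *: bop_comp T A); split; first exact: tensor_sumZ.
- apply: rnorm_bop_le => u u1.
  rewrite -[X in rnorm X]/(T u - ofReal s t^-1 *: A (T u)).
  have -> : T u - ofReal s t^-1 *: A (T u) =
      - (ofReal s t^-1 *: (A (T u) - ofReal s t *: T u)).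
    rewrite scalerBr scalerA -ofRealM mulVf ?gt_eqF // ofReal1 scale1r.
    by rewrite opprB.
  rewrite rnormN rnormZr ?invr_ge0 ?(ltW t0) // mulrC ler_pM2r ?invr_gt0 //.
  by apply: A_id; apply: le_trans (bop_le_rnorm _ _) _; rewrite T1 mul1r.
- rewrite rnormZr ?invr_ge0 ?(ltW t0) // mulrC ler_pM2l ?invr_gt0 //.
  apply: (@le_trans _ _ (rnorm (A (T x)))); last first.
    apply: le_trans (bop_le_rnorm (bop_comp T A) x) _.
    by rewrite ler_piMr ?rnorm_ge0.
  rewrite lerBlDr; apply: le_trans (ltW Tx) _.
  rewrite -{1}[T x](subrK (A (T x))) addrC.
  by apply: le_trans (rnormD _ _) _; rewrite lerD2l rnormB.
Qed.

Theorem mainTheorem5 (R : realType) (s : scalars) (p : R) (p1 : 1 < p)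
    (E F : completeNormedModType (scalarField R s))
    (F_separable : separable_space F) (F_Lp1plus : Lp1plus (ltW p1) F)
    (dualE_separable : separable_space (dual E))
    (Z : linSubspace (bop E F)) (Z_closed : closed Z)
    (Z_finite_rank : [set T : bop E F | finite_rank T] `<=` Z) :
  UBCP (linSubspace_type Z).
Proof.
have [f f_dense] := separable_dense_sequence dualE_separable.
have [y y_dense] := separable_dense_sequence F_separable.
have [r0 [r1 [r0_gt0 r01 approx]]] := tensor_approximation_unit_operators E F_Lp1plus.
exact: (@UBCP_of_tensor_approximation R s E F f y f_dense y_dense Z r0 r1
  Z_finite_rank r0_gt0 r01 approx).
Qed.
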